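(* Let $\mu$ be a finite Borel measure on $(-\pi,\pi)$ and let $\mu^\#$ be its symmetrization. Let $u_\mu$ and $u_{\mu^\#}$ be the corresponding solutions of the Dirichlet problem $-u''=\mu$ on $(-\pi,\pi)$ in the sense of distributions, $u(-\pi)=u(\pi)=0$. Then \[\int_{-\pi}^{\pi}\phi\bigl(u_\mu(x)\bigr)\,dx\le\int_{-\pi}^{\pi}\phi\bigl(u_{\mu^\#}(x)\bigr)\,dx\] for every convex and increasing function $\phi:\mathbb{R}\to\mathbb{R}$. Moreover, if $\phi$ is strictly convex (and increasing), equality holds if and only if the Radon–Nikodym derivative $f$ of $\mu$ equals its symmetric decreasing rearrangement $f^\#$ a.e. on $(-\pi,\pi)$ and the singular part of $\mu$ is a (nonnegative multiple of a) Dirac mass at the origin, i.e. if and only if $\mu=\mu^\#$.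
   Context: A ''Borel measure on $(-\pi,\pi)$'' means a positive measure on the Borel $\sigma$-algebra of $(-\pi,\pi)$ that is not the zero measure; $\lambda$ is Lebesgue measure. Green's function: $G(x,y)=-\frac{xy}{2\pi}-\frac12|x-y|+\frac{\pi}{2}$ for $x,y\in[-\pi,\pi]$. For a finite Borel measure $\mu$ on $(-\pi,\pi)$, $u_\mu(x)=\int_{-\pi}^{\pi}G(x,y)\,d\mu(y)$; this is the unique absolutely continuous function on $[-\pi,\pi]$ with $-u_\mu''=\mu$ in the sense of distributions on $(-\pi,\pi)$ and $u_\mu(\pm\pi)=0$. Every finite Borel measure $\mu$ on $(-\pi,\pi)$ decomposes uniquely as $\mu=\nu+\sigma+\delta$, where $\nu\ll\lambda$ with $d\nu=f\,d\lambda$ for some $0\le f\in L^1[-\pi,\pi]$ (the Radon–Nikodym derivative of $\mu$), $\sigma\perp\lambda$ has no atoms, and $\delta=\sum_i a_i\delta_{x_i}$ is purely discontinuous (distinct points $x_i\in(-\pi,\pi)$, $a_i\ge0$, $\sum a_i<\infty$); the singular part of $\mu$ is $\sigma+\delta$. Decreasing rearrangement of $f\in L^1[-\pi,\pi]$: $f^*(0)=\operatorname{ess\,sup}f$, $f^*(2\pi)=\operatorname{ess\,inf}f$, and $f^*(t)=\inf\{s\in\mathbb{R}:\lambda(\{x\in[-\pi,\pi]:f(x)>s\})\le t\}$ for $t\in(0,2\pi)$; the symmetric decreasing rearrangement is $f^\#(t)=f^*(2|t|)$, $t\in[-\pi,\pi]$. The symmetrization of $\mu$ is the measure $\mu^\#$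 with $d\mu^\#=f^\#\,d\lambda+M\,d\delta_0$, where $M=\sigma((-\pi,\pi))+\delta((-\pi,\pi))$ and $\delta_0$ is the unit Dirac mass at $0$. *)

(* Defs.v *)
From HB Require Import structures.
From mathcomp Require Import all_boot all_order all_algebra.
From mathcomp Require Import all_classical all_reals all_analysis.
Set Implicit Arguments. Unset Strict Implicit. Unset Printing Implicit Defensive.
Import Order.TTheory GRing.Theory Num.Theory Num.Def.
Import numFieldNormedType.Exports.
Local Open Scope classical_set_scope.
Local Open Scope ring_scope.

Section defs.
Context {R : realType}.

(* Green's function of -u'' on (-pi,pi) with Dirichlet boundary conditions *)
Definition green (x y : R) : R :=
  - (x * y) / (2 * pi) - `|x - y| / 2 + pi / 2.

Definition green_pot (mu : {measure set (measurableTypeR R) -> \bar R}) (x : R) : R :=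
  fine (\int[mu]_(y in `](- pi)%R, pi[%classic) (green x y)%:E)%E.

(* decreasing rearrangement f^* of f on [-pi,pi]; values in \bar R since
   f^*(0) = ess sup f may be +oo *)
Definition decr_rearr (f : R -> R) (t : R) : \bar R :=
  if t == 0 then
    ereal_inf [set y : \bar R | {ae (@lebesgue_measure R),
                 forall x, `[(- pi)%R, pi]%classic x -> ((f x)%:E <= y)%E}]
  else if t == 2 * pi then
    ereal_sup [set y : \bar R | {ae (@lebesgue_measure R),
                 forall x, `[(- pi)%R, pi]%classic x -> (y <= (f x)%:E)%E}]
  else
    ereal_inf [set s%:E | s in [set s : R |
       (@lebesgue_measure R ([set x | `[(- pi)%R, pi]%classic x /\ (s < f x)%R]) <= t%:E)%E]].

Definition sym_rearr (f : R -> R) (t : R) : \bar R := decr_rearr f (2 * `|t|).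

Definition convex_fun (phi : R -> R) : Prop :=
  forall x y t : R, 0 <= t <= 1 ->
    phi (t * x + (1 - t) * y) <= t * phi x + (1 - t) * phi y.

Definition strictly_convex_fun (phi : R -> R) : Prop :=
  forall x y t : R, x != y -> 0 < t < 1 ->
    phi (t * x + (1 - t) * y) < t * phi x + (1 - t) * phi y.

Definition nondecr_fun (phi : R -> R) : Prop :=
  forall x y : R, x <= y -> phi x <= phi y.

End defs.

(* Main.v *)
Require Import Defs.
From HB Require Import structures.
From mathcomp Require Import all_boot all_order all_algebra.
From mathcomp Require Import all_classical all_reals all_analysis.
From mathcomp Require Import measurable_realfun.
From mathcomp Require Import ring lra.
Import Order.TTheory GRing.Theory Num.Theory Num.Def.
Import numFieldNormedType.Exports.
Set Implicit Arguments. Unset Strict Implicit. Unset Printing Implicit Defensive.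
Local Open Scope classical_set_scope.
Local Open Scope ring_scope.

(** Write u and v for the potentials of mu and of its symmetrization, and
    F r for the mass that the latter gives to ]-r, r[.  The set {u >= t} is an
    interval [a(t), b(t)]; let w(t) = (b(t) - a(t)) / 2.  For levels t < t',
    put x = a(t') - a(t) and y = b(t) - b(t').  The chords of u over these two
    end pieces have slopes (t' - t) / x and -(t' - t) / y, and the difference of
    the slopes is at most mu ]a(t), b(t)[, hence at most F(w(t)) by the
    Hardy-Littlewood inequality; since w(t) - w(t') = (x + y) / 2, the inequality
    4xy <= (x + y)^2 gives t' - t <= (w(t) - w(t')) F(w(t)) / 2.  On the other
    hand v(w(t')) - v(w(t)) >= (w(t) - w(t')) F(w(t')) / 2.  Summing over finer
    and finer uniform subdivisions of the levels, on which the jumps of F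
    telescope, yields v(w(t)) >= t.  Thus {u >= t} is no longer than {v >= t}, and
    all integrals of nondecreasing functions are ordered.

    If the integrals agree for a strictly increasing phi, then the superlevel
    sets of u and v have equal lengths, so v(w(t)) = t, and the two bounds
    become (x - y)^2 F(w(t')) <= (x + y)^2 (F(w(t)) - F(w(t'))).  The same
    telescoping shows that a(t) + b(t) is constant, hence 0: u is even, u = v,
    and the measures coincide. *)

(** * Lipschitz functions and level intervals *)

Section lipschitz.
Context {R : realType}.
Implicit Types (f : R -> R) (K : R).

Definition lipschitz_with K f := forall x y, `|f x - f y| <= K * `|x - y|.

Lemma lipschitz_with_continuous K f : lipschitz_with K f -> continuous f.
Proof.
move=> lip x; apply/cvgrPdist_lt => e e0.
have K1 : 0 < `|K| + 1 by have := normr_ge0 K; lra.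
have d0 : 0 < e / (`|K| + 1) by exact: divr_gt0.
near=> y.
have xy : `|x - y| < e / (`|K| + 1) by near: y; exact: cvgr_dist_lt.
apply: le_lt_trans (lip x y) _; move: xy; rewrite ltr_pdivlMr//.
have : K * `|x - y| <= (`|K| + 1) * `|x - y|.
  by apply: ler_wpM2r => //; have := ler_norm K; lra.
lra.
Unshelve. all: by end_near. Qed.

Lemma lipschitz_with_measurable K f : lipschitz_with K f ->
  measurable_fun setT (f : measurableTypeR R -> R).
Proof. by move=> /lipschitz_with_continuous/continuous_measurable_fun. Qed.

End lipschitz.

Lemma addr_le_eq (R : realDomainType) (a b c d : R) :
  a <= c -> b <= d -> a + b = c + d -> a = c.
Proof. by move=> ac bd abcd; apply/eqP; rewrite eq_le ac/=; lra. Qed.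

Section lipschitz_real.
Context {R : realType}.
Implicit Types (g : R -> R) (K L : R).

Lemma lipschitz_lt_right K g x z L : 0 <= K -> lipschitz_with K g -> x < L -> z < g x ->
  exists y, [/\ x < y, y <= L & z < g y].
Proof.
move=> K0 lip xL zx.
(* This step satisfies [K * d < g x - z]; adding 1 to [K] keeps the divisor positive when
   [K = 0]. *)
pose d := (g x - z) / (2 * (K + 1)).
have d0 : 0 < d by rewrite divr_gt0//; lra.
have dE : d * (2 * (K + 1)) = g x - z by rewrite divfK// gt_eqF//; lra.
pose y := Num.min L (x + d).
have xy : x < y by rewrite lt_min xL/=; lra.
have yd : y <= x + d by rewrite ge_min lexx orbT.
exists y; split => //; first by rewrite ge_min lexx.
have := lip x y; rewrite (distrC x y) (gtr0_norm (_ : 0 < y - x)); last lra.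
move=> /(le_trans (ler_norm _)).
have : K * (y - x) <= K * d by apply: ler_wpM2l => //; lra.
have : 0 <= K * d by rewrite mulr_ge0// ltW.
lra.
Qed.

Lemma lipschitz_lt_left K g x z : 0 <= K -> lipschitz_with K g -> 0 < x -> g x < z ->
  exists y, [/\ 0 <= y, y < x & g y < z].
Proof.
move=> K0 lip x0 zx.
have lip' : lipschitz_with K (fun y => - g (- y)).
  move=> a b; have -> : - g (- a) - - g (- b) = g (- b) - g (- a) by ring.
  have -> : a - b = - b - - a by ring.
  exact: lip.
have [||y [xy y0 gy]] := @lipschitz_lt_right K _ (- x) (- z) 0 K0 lip'.
- lra.
- by rewrite opprK; lra.
- by exists (- y); split; lra.
Qed.

End lipschitz_real.

Section levels.
Context {R : realType}.
Implicit Types (u v F g : R -> R).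

(** Over [n.+1] equal steps of length [h], the errors [e] add up to [T * e], while the differences
    of [Phi] telescope to [h * K * (Phi 0 - Phi T)], which vanishes as [n] grows. The constant [K]
    may depend on [e] but not on the two levels. *)
Lemma telescope_le (g Phi : R -> R) (T : R) : 0 <= T ->
  (forall e : R, 0 < e -> exists K : R, forall t t' : R, 0 <= t -> t < t' -> t' <= T ->
     g t' - g t <= (t' - t) * (e + K * (Phi t - Phi t'))) ->
  g T <= g 0.
Proof.
move=> T0 H; have [->//|TN0] := eqVneq T 0.
have {TN0}T0 : 0 < T by lra.
apply/ler_addgt0Pr => e e0.
have e20 : 0 < e / 2 by rewrite divr_gt0.
have [K HK] := H _ (divr_gt0 e20 T0).
(* The errors, taken as [e / 2 / T] per unit of level, use up one half of [e]; this [n] makes the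
   telescoped remainder smaller than the other half. *)
have [n ltn] : exists n : nat, `|T * K * (Phi 0 - Phi T)| < (e / 2) * n.+1%:R.
  exists (truncn (`|T * K * (Phi 0 - Phi T)| / (e / 2))).
  by rewrite [ltRHS]mulrC -ltr_pdivrMr//; exact: truncnS_gt.
have n0 : (0 : R) < n.+1%:R by rewrite ltr0n.
have [h hE] : exists h, h = T / n.+1%:R by exists (T / n.+1%:R).
have h0 : 0 < h by rewrite hE divr_gt0.
have nh : n.+1%:R * h = T by rewrite hE mulrC divfK// gt_eqF.
have step i : (i <= n.+1)%N ->
    g (i%:R * h) - g 0 <=
      h * (i%:R * (e / 2 / T) + K * (Phi 0 - Phi (i%:R * h))).
  elim: i => [_|i IH lin]; first by rewrite !mul0r !subrr !(mulr0, addr0).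
  have {}IH := IH (ltnW lin).
  have := HK (i%:R * h) (i.+1%:R * h).
  have iS : i.+1%:R = i%:R + 1 :> R by rewrite -natr1.
  have i0 : (0 : R) <= i%:R * h by rewrite mulr_ge0// ltW.
  have iT : i.+1%:R * h <= T by rewrite -nh ler_pM2r// ler_nat.
  have dh : i.+1%:R * h - i%:R * h = h by rewrite iS; ring.
  by move=> /(_ i0 ltac:(lra) iT); rewrite dh iS; lra.
have := step _ (leqnn _); rewrite nh.
have -> : h * (n.+1%:R * (e / 2 / T) + K * (Phi 0 - Phi T)) =
   e / 2 + (T * K * (Phi 0 - Phi T)) / n.+1%:R.
  by rewrite hE; field; rewrite addrC natr1 !gt_eqF.
have : T * K * (Phi 0 - Phi T) / n.+1%:R <= e / 2.
  by rewrite ler_pdivrMr// (le_trans (ler_norm _))// ltW.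
move: (_ / n.+1%:R) => q; lra.
Qed.

(** The interval [a, b] is the convex hull of the superlevel set at level [t] inside [-L, L], with
    both endpoints exactly on the level. For quasiconcave [u] it is the superlevel set itself. *)
Definition level_itv (L : R) u t a b :=
  [/\ - L <= a, a <= b, b <= L, u a = t & u b = t] /\
  forall x, - L <= x <= L -> t <= u x -> a <= x <= b.

(** The point is the supremum of the superlevel set. A value above [t] there would persist a little
    to the right, and a value below [t] would contradict the points of the set that accumulate at
    it. *)
Lemma last_level (L K : R) u (c t : R) : 0 <= K ->
  lipschitz_with K u ->
  c <= L -> u L <= t -> t <= u c ->
  exists b, [/\ c <= b, b <= L, u b = t & forall x, x <= L -> t <= u x -> x <= b].
Proof.
move=> K0 lip cL uL uc.
pose B := [set x | x <= L /\ t <= u x].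
have Bc : B c by [].
have hB : has_sup B by split; [exists c | exists L => x []].
have cb : c <= sup B by apply: ub_le_sup => //; case: hB.
have bL : sup B <= L by apply: ge_sup; [exists c | move=> x []].
have Bub x : x <= L -> t <= u x -> x <= sup B.
  by move=> xL tx; apply: ub_le_sup => //; case: hB.
have lipr x y : x <= y -> `|u x - u y| <= K * (y - x).
  by move=> xy; rewrite (le_trans (lip _ _))// ler0_norm ?opprB//; lra.
exists (sup B); split=> //; apply/eqP; rewrite eq_le; apply/andP; split.
- rewrite leNgt; apply/negP => tu.
  have bLs : sup B < L.
    by rewrite lt_neqAle bL andbT; apply/eqP => bE; move: tu; rewrite bE; lra.
  pose d := (u (sup B) - t) / (K + 1).
  have d0 : 0 < d by apply: divr_gt0; lra.
  have dK : d * (K + 1) = u (sup B) - t by rewrite divfK//; lra.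
  pose x := Num.min L (sup B + d).
  have bx : sup B < x by rewrite lt_min bLs/=; lra.
  have xd : x <= sup B + d by rewrite ge_min lexx orbT.
  suff : x <= sup B by lra.
  apply: Bub; first by rewrite ge_min lexx.
  have := lipr _ _ (ltW bx).
  rewrite ler_norml => /andP[_].
  have : K * (x - sup B) <= K * d by apply: ler_wpM2l => //; lra.
  lra.
- apply/ler_addgt0Pr => e e0.
  have d0 : 0 < e / (K + 1) by apply: divr_gt0; lra.
  have [x [xL tx] xb] := sup_adherent d0 hB.
  have xb' := Bub _ xL tx.
  have := lipr _ _ xb'.
  rewrite ler_norml => /andP[_ l].
  have : K * (sup B - x) <= K * (e / (K + 1)) by apply: ler_wpM2l => //; lra.
  have : e / (K + 1) * (K + 1) = e by rewrite divfK//; lra.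
  lra.
Qed.

Lemma level_itv_exists (L K : R) u (c t : R) : 0 <= K ->
  lipschitz_with K u ->
  - L <= c <= L -> u (- L) <= t -> u L <= t -> t <= u c ->
  exists a b, level_itv L u t a b /\ a <= c <= b.
Proof.
move=> K0 lip /andP[Lc cL] uNL uL uc.
have [b [cb bL ub Hb]] := last_level K0 lip cL uL uc.
(* The left endpoint is the last level point of the reflected function. *)
have lip' : lipschitz_with K (fun x => u (- x)).
  by move=> x y; rewrite (le_trans (lip _ _))// distrC opprK addrC.
have [||a [ca aL ua Ha]] := @last_level L K (fun x => u (- x)) (- c) t K0 lip' _ uNL.
- by lra.
- by rewrite opprK.
exists (- a), b; split; last by apply/andP; split; lra.
split; first by split => //; lra.
move=> x /andP[Lx xL] tx; rewrite Hb// andbT.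
have : - x <= a by apply: Ha; rewrite ?opprK//; lra.
lra.
Qed.

Lemma level_itv_uniq (L : R) u t a b a' b' :
  level_itv L u t a b -> level_itv L u t a' b' -> a = a' /\ b = b'.
Proof.
move=> [[La ab bL ua ub] H] [[La' ab' bL' ua' ub'] H'].
have /andP[h1 h2] : a <= a' <= b by apply: H; [apply/andP; split; lra | rewrite ua'].
have /andP[h3 h4] : a <= b' <= b by apply: H; [apply/andP; split; lra | rewrite ub'].
have /andP[h5 h6] : a' <= a <= b' by apply: H'; [apply/andP; split; lra | rewrite ua].
have /andP[h7 h8] : a' <= b <= b' by apply: H'; [apply/andP; split; lra | rewrite ub].
by split; lra.
Qed.

End levels.

(** * Level intervals of [u] against the values of [v], for abstract [u], [v] and mass function
    [F] *)

Section comparison.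
Context {R : realType} (L K : R) (u v F : R -> R).

Hypothesis K0 : 0 <= K.
Hypothesis u_lip : lipschitz_with K u.
Hypothesis uNL : u (- L) = 0.
Hypothesis uL : u L = 0.
Hypothesis slopes_le : forall a a' b' b : R, - L <= a -> a < a' -> a' <= b' -> b' < b -> b <= L ->
  (u a' - u a) / (a' - a) + (u b' - u b) / (b - b') <= F ((b - a) / 2).
Hypothesis F_ndecr : forall r s : R, 0 <= r -> r <= s -> s <= L -> F r <= F s.
Hypothesis F_ge0 : forall r, 0 <= F r.
Hypothesis vL : v L = 0.
Hypothesis v_drop : forall r s : R, 0 <= r -> r <= s -> s <= L -> (s - r) * F r <= 2 * (v r - v s).

Local Notation lev := (level_itv L u).
Local Notation hw a b := ((b - a) / 2).

Let lev_ex c t : - L <= c <= L -> 0 <= t -> t <= u c ->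
  exists a b, lev t a b /\ a <= c <= b.
Proof.
move=> cL t0 tc; apply: (@level_itv_exists _ L K) tc => //; last by rewrite uL.
by rewrite uNL.
Qed.

Lemma v_nincr r s : 0 <= r -> r <= s -> s <= L -> v s <= v r.
Proof.
move=> r0 rs sL; have := v_drop r0 rs sL.
have : 0 <= (s - r) * F r by rewrite mulr_ge0//; lra.
lra.
Qed.

(** The hypothesis on chord slopes, multiplied by the product of the two end lengths. [F] is
    positive because it dominates a sum of two positive slopes. *)
Lemma level_step t t' a b a' b' : t < t' -> lev t a b -> lev t' a' b' ->
  [/\ 0 < a' - a, 0 < b - b', 0 < F (hw a b) &
   (t' - t) * ((a' - a) + (b - b')) <= (a' - a) * (b - b') * F (hw a b)].
Proof.
move=> tt' [[La ab bL ua ub] H] [[La' ab' bL' ua' ub'] H'].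
have /andP[h1 h2] : a <= a' <= b.
  by apply: H; [apply/andP; split; lra | rewrite ua' ltW].
have /andP[h3 h4] : a <= b' <= b.
  by apply: H; [apply/andP; split; lra | rewrite ub' ltW].
have aa' : a < a'.
  by rewrite lt_neqAle h1 andbT; apply/eqP => E; move: ua; rewrite E; lra.
have bb' : b' < b.
  by rewrite lt_neqAle h4 andbT; apply/eqP => E; move: ub; rewrite -E; lra.
have x0 : 0 < a' - a by lra.
have y0 : 0 < b - b' by lra.
have := slopes_le La aa' ab' bb' bL.
rewrite ua ub ua' ub' => sl.
have Dx : 0 < (t' - t) / (a' - a) by apply: divr_gt0; lra.
have Dy : 0 < (t' - t) / (b - b') by apply: divr_gt0; lra.
split=> //; first lra.
have -> : (t' - t) * (a' - a + (b - b')) =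
  (a' - a) * (b - b') * ((t' - t) / (a' - a) + (t' - t) / (b - b')).
  by field; rewrite !gt_eqF.
by apply: ler_wpM2l sl; rewrite mulr_ge0// ltW.
Qed.

Lemma level_hw t a b : lev t a b -> 0 <= hw a b <= L.
Proof. by move=> [[? ? ? _ _] _]; apply/andP; split; lra. Qed.

(** Telescoping needs the endpoints as functions of the level, so they are selected by choice;
    outside the range of relevant levels the value is a dummy pair. *)
Let lev_fun c : - L <= c <= L -> exists a b : R -> R,
  forall t, 0 <= t -> t <= u c -> lev t (a t) (b t).
Proof.
move=> cL.
have H (t : R) : exists p : R * R, 0 <= t -> t <= u c -> lev t p.1 p.2.
  have [/andP[t0 tc]|tN] := boolP (0 <= t <= u c); last first.
    by exists (0, 0) => t0 tc; rewrite t0 tc in tN.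
  by have [a [b [l _]]] := lev_ex cL t0 tc; exists (a, b).
have [p Hp] := choice H.
by exists (fst \o p), (snd \o p).
Qed.

Let level_lt_hw t t' a b a' b' : t < t' -> lev t a b -> lev t' a' b' ->
  [/\ 0 <= hw a' b', hw a' b' <= hw a b & hw a b <= L].
Proof.
move=> tt' l l'; have [x0 y0 _ _] := level_step tt' l l'.
have /andP[? ?] := level_hw l; have /andP[? ?] := level_hw l'.
by split => //; lra.
Qed.

(** Telescoping is applied to [t - v (w t)], with [F \o w] as the controlling function. Having a
    level [u c] strictly above [T] makes [F (w T)] positive, so its inverse can serve as the
    constant [K]. *)
Lemma level_le_v_strict T a b c : - L <= c <= L -> 0 <= T -> T < u c ->
  lev T a b -> T <= v (hw a b).
Proof.
move=> cL T0 Tc lT.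
have [A [B AB]] := lev_fun cL.
have lTT := AB _ T0 (ltW Tc).
have [aE bE] := level_itv_uniq lT lTT.
have [_ _ FT _] := level_step Tc lTT (AB _ (le_trans T0 (ltW Tc)) (lexx _)).
pose w t := hw (A t) (B t).
rewrite aE bE -[hw _ _]/(w T).
suff : T - v (w T) <= 0 - v (w 0).
  have l0 := AB 0 (lexx _) (le_trans T0 (ltW Tc)).
  have : 0 <= v (w 0).
    by have /andP[? ?] := level_hw l0; rewrite -[leLHS]vL; apply: v_nincr.
  lra.
apply: (@telescope_le _ (fun t => t - v (w t)) (F \o w)) => // e e0.
exists (F (w T))^-1 => t t' t0 tt' t'T /=.
have lt := AB _ t0 (le_trans (ltW tt') (le_trans t'T (ltW Tc))).
have lt' := AB t' (le_trans t0 (ltW tt')) (le_trans t'T (ltW Tc)).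
have [x0 y0 Fs stp] := level_step tt' lt lt'.
have [r0 rs sL] := level_lt_hw tt' lt lt'.
have Fw : F (w T) <= F (w t').
  have [->//|/negPf t'NT] := eqVneq t' T.
  have t'T' : t' < T by rewrite lt_neqAle t'NT t'T.
  have [? ? ?] := level_lt_hw t'T' lt' lTT.
  exact: F_ndecr.
have Frs : F (w t') <= F (w t) by apply: F_ndecr.
have vd := v_drop r0 rs sL; rewrite -!/(w _) in Fs stp r0 rs sL vd.
set x := A t' - A t in x0 stp; set y := B t - B t' in y0 stp.
have sr : w t - w t' = (x + y) / 2 by rewrite /w /x /y; lra.
rewrite sr in vd.
(* This is [level_step] combined with [4 * x * y <= (x + y) ^+ 2] and divided by [x + y]. *)
have key : (t' - t) * 4 <= (x + y) * F (w t).
  have xy : 0 < x + y by lra.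
  rewrite -(ler_pM2r xy).
  have : x * y * F (w t) * 4 <= (x + y) * (x + y) * F (w t).
    rewrite mulrAC; apply: ler_wpM2r; first lra.
    have : 0 <= (x - y) ^+ 2 by exact: sqr_ge0.
    lra.
  nra.
have Fr : 0 < F (w t') by lra.
have vge : (t' - t) * (F (w t') / F (w t)) <= v (w t') - v (w t).
  rewrite mulrA ler_pdivrMr//.
  have : (t' - t) * 4 * F (w t') <= (x + y) * F (w t) * F (w t').
    by apply: ler_wpM2r => //; lra.
  have : (x + y) / 2 * F (w t') * F (w t) <= 2 * (v (w t') - v (w t)) * F (w t).
    by apply: ler_wpM2r => //; lra.
  lra.
(* The relative loss in the step is at most the jump of [F \o w] divided by [F (w T)], the smallest
   value of [F \o w] on the levels up to [T]. *)
have : 1 - F (w t') / F (w t) <= e + (F (w T))^-1 * (F (w t) - F (w t')).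
  have -> : 1 - F (w t') / F (w t) = (F (w t))^-1 * (F (w t) - F (w t')).
    by field; rewrite gt_eqF.
  have : (F (w t))^-1 * (F (w t) - F (w t')) <= (F (w T))^-1 * (F (w t) - F (w t')).
    by apply: ler_wpM2r; [lra | rewrite lef_pV2 ?posrE//; lra].
  lra.
rewrite -(ler_pM2l (_ : 0 < t' - t)); last lra.
lra.
Qed.

(** At the top level no higher value is available, so the strict case is applied at [T - e]. Its
    interval is wider, hence [v] at its half-width is no larger than at that of [a, b]. *)
Lemma level_le_v T a b : 0 <= T -> lev T a b -> T <= v (hw a b).
Proof.
move=> T0 lT; have [[La ab bL ua ub] _] := lT.
have /andP[w0 wL] := level_hw lT.
have aL : - L <= a <= L by apply/andP; split; lra.
have v0 : 0 <= v (hw a b) by rewrite -[leLHS]vL; apply: v_nincr.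
apply/ler_addgt0Pr => e e0.
have [|t0] := ltP (T - e) 0; first by lra.
have tT : T - e < T by lra.
have [|a' [b' [l' _]]] := @lev_ex a (T - e) aL t0; first by rewrite ua; lra.
have [x0 y0 _ _] := level_step tT l' lT.
have := @level_le_v_strict (T - e) a' b' a aL t0 ltac:(by rewrite ua; lra) l'.
have /andP[w0' wL'] := level_hw l'.
have : v (hw a' b') <= v (hw a b) by apply: v_nincr => //; lra.
lra.
Qed.

(** * The equality case: symmetry of the level intervals *)

Section equality.
Hypothesis v_level : forall t a b c, - L <= c <= L -> 0 <= t -> t < u c ->
  lev t a b -> v (hw a b) = t.

(** Telescoping [A + B] and its opposite shows that the midpoint of the level interval does not move
    with the level. At level 0 the interval is all of [-L, L], whose midpoint is 0. *)
Lemma level_sym T a b c : - L <= c <= L -> 0 <= T -> T < u c ->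
  lev T a b -> a = - b.
Proof.
move=> cL T0 Tc lT.
have [A [B AB]] := lev_fun cL.
have lTT := AB _ T0 (ltW Tc).
have [aE bE] := level_itv_uniq lT lTT.
have [_ _ FT _] := level_step Tc lTT (AB _ (le_trans T0 (ltW Tc)) (lexx _)).
pose w t := hw (A t) (B t).
have [[LA0 AB0 B0L uA0 uB0] l0] := AB 0 (lexx _) (le_trans T0 (ltW Tc)).
have /andP[A0 _] : A 0 <= - L <= B 0.
  by apply: l0; [apply/andP; split; lra | rewrite uNL].
have /andP[_ B0] : A 0 <= L <= B 0.
  by apply: l0; [apply/andP; split; lra | rewrite uL].
have key e : 0 < e -> exists K, forall t t', 0 <= t -> t < t' -> t' <= T ->
    `|(A t' + B t') - (A t + B t)| <= (t' - t) * (e + K * ((F \o w) t - (F \o w) t')).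
  move=> e0.
  (* The AM-GM weight: since [x + y <= D * (4 / fT)], its contribution [(x + y) * (eta / 2)] is then
     at most [D * e]. *)
  pose eta := e * F (w T) / 2.
  have eta0 : 0 < eta by rewrite /eta divr_gt0// mulr_gt0.
  exists (2 / (eta * F (w T) ^+ 2)) => t t' t0 tt' t'T /=.
  have lt := AB _ t0 (le_trans (ltW tt') (le_trans t'T (ltW Tc))).
  have t'c : t' < u c by lra.
  have t'0 : 0 <= t' by lra.
  have tc : t < u c by lra.
  have lt' := AB t' t'0 (ltW t'c).
  have [x0 y0 Fs stp] := level_step tt' lt lt'.
  have [r0 rs sL] := level_lt_hw tt' lt lt'.
  have Fw : F (w T) <= F (w t').
    have [->//|/negPf t'NT] := eqVneq t' T.
    have t'T' : t' < T by rewrite lt_neqAle t'NT t'T.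
    have [? ? ?] := level_lt_hw t'T' lt' lTT.
    exact: F_ndecr.
  have Frs : F (w t') <= F (w t) by apply: F_ndecr.
  have vd := v_drop r0 rs sL.
  rewrite (v_level cL t'0 t'c lt') (v_level cL t0 tc lt) in vd.
  rewrite -!/(w _) in Fs stp r0 rs sL vd FT.
  set x := A t' - A t in x0 stp; set y := B t - B t' in y0 stp.
  have sr : w t - w t' = (x + y) / 2 by rewrite /w /x /y; lra.
  rewrite sr in vd.
  have -> : A t' + B t' - (A t + B t) = x - y by rewrite /x /y; lra.
  set fs := F (w t) in Fs stp Frs *; set fr := F (w t') in Fw Frs vd *.
  set fT := F (w T) in FT Fw eta eta0 *; set D := t' - t in stp vd *.
  have fr0 : 0 < fr by lra.
  have xy0 : 0 < x + y by lra.
  (* Here [v (w t) = t] turns the drop of [v] into [(x + y) * fr <= 4 * D], and [level_step] bounds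
     [D * (x + y)] by [x * y * fs]. Subtracting [4 * x * y * fr] leaves the jump [fs - fr] on the
     right. *)
  have sq : (x - y) ^+ 2 * fr <= (x + y) ^+ 2 * (fs - fr).
    have h1 : (x + y) ^+ 2 * fr <= 4 * (x * y) * fs.
      have : (x + y) / 2 * fr * (x + y) <= 2 * D * (x + y) by apply: ler_wpM2r; lra.
      lra.
    have h2 : 4 * (x * y) * (fs - fr) <= (x + y) ^+ 2 * (fs - fr).
      apply: ler_wpM2r; first lra.
      have : 0 <= (x - y) ^+ 2 by exact: sqr_ge0.
      lra.
    lra.
  have sq' : `|x - y| ^+ 2 <= (x + y) ^+ 2 * ((fs - fr) / fT).
    rewrite real_normK ?num_real// mulrA ler_pdivlMr//.
    apply: le_trans sq; apply: ler_wpM2l => //; exact: sqr_ge0.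
  (* AM-GM: [|x - y| <= eta (x + y) / 2 + (x - y)^2 / (2 eta (x + y))] *)
  have amgm : `|x - y| <= (x + y) * (eta / 2 + (fs - fr) / fT / (2 * eta)).
    have sqn : 0 <= (`|x - y| - eta * (x + y)) ^+ 2 by exact: sqr_ge0.
    rewrite -(ler_pM2r (_ : 0 < 2 * eta * (x + y))); last first.
      by rewrite mulr_gt0// mulr_gt0.
    have -> : (x + y) * (eta / 2 + (fs - fr) / fT / (2 * eta)) * (2 * eta * (x + y))
      = eta ^+ 2 * (x + y) ^+ 2 + (x + y) ^+ 2 * ((fs - fr) / fT).
      by field; rewrite !gt_eqF.
    lra.
  apply: (le_trans amgm).
  have xyD : x + y <= D * (4 / fT).
    rewrite mulrA ler_pdivlMr//.
    have : (x + y) * fT <= (x + y) * fr by apply: ler_wpM2l => //; lra.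
    lra.
  have -> : D * (e + 2 / (eta * fT ^+ 2) * (fs - fr)) =
     D * (4 / fT) * (eta / 2 + (fs - fr) / fT / (2 * eta)).
    have -> : e = 2 * eta / fT by rewrite /eta; field; rewrite gt_eqF.
    by field; rewrite !gt_eqF.
  apply: ler_wpM2r xyD; apply: addr_ge0; first lra.
  by apply: divr_ge0; [apply: divr_ge0; lra | lra].
have S1 : A T + B T <= A 0 + B 0.
  apply: (@telescope_le _ (fun t => A t + B t) (F \o w)) => // e /key[K1 HK1].
  exists K1 => t t' t0 tt' t'T; apply: le_trans (HK1 _ _ t0 tt' t'T).
  exact: ler_norm.
have S2 : - (A T + B T) <= - (A 0 + B 0).
  apply: (@telescope_le _ (fun t => - (A t + B t)) (F \o w)) => // e /key[K1 HK1].
  exists K1 => t t' t0 tt' t'T; apply: le_trans (HK1 _ _ t0 tt' t'T).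
  by rewrite -opprB opprK addrC -normrN opprB; exact: ler_norm.
rewrite aE bE; lra.
Qed.

Hypothesis u_qc : forall x y z t, x <= y -> y <= z -> t <= u x -> t <= u z -> t <= u y.

Let u_ge0 x : - L <= x <= L -> 0 <= u x.
Proof. by move=> /andP[? ?]; apply: (@u_qc (- L) _ L) => //; rewrite ?uNL ?uL. Qed.

(** The level interval at [u x - e] contains [x] and is symmetric, so it contains [- x]; by
    quasiconcavity [u] is at least [u x - e] there. *)
Let u_le_opp x : - L <= x <= L -> u x <= u (- x).
Proof.
move=> xL; have NxL : - L <= - x <= L by move/andP: xL => [? ?]; apply/andP; split; lra.
have [ux0|ux0] := ltP 0 (u x); last exact: le_trans ux0 (u_ge0 NxL).
apply/ler_addgt0Pr => e e0.
have [tl|tl] := ltP (u x - e) 0; first by have := u_ge0 NxL; lra.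
have tx : u x - e < u x by lra.
have [a [b [l /andP[ax xb]]]] := lev_ex xL tl (ltW tx).
have abE := level_sym xL tl tx l.
have [[_ _ _ ua ub] _] := l.
have : u x - e <= u (- x).
  by apply: (@u_qc a _ b); rewrite ?ua ?ub//; lra.
lra.
Qed.

Lemma u_even x : - L <= x <= L -> u (- x) = u x.
Proof.
move=> xL; apply/eqP; rewrite eq_le u_le_opp// andbT -[in leRHS](opprK x) u_le_opp//.
by move/andP: xL => [? ?]; apply/andP; split; lra.
Qed.

Lemma u_nincr x y : 0 <= x -> x <= y -> y <= L -> u y <= u x.
Proof.
move=> x0 xy yL; apply: (@u_qc (- y) _ y) => //; first lra.
by rewrite u_even//; apply/andP; split; lra.
Qed.

End equality.
End comparison.

(** * The Green potential *)

Section green_kernel.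
Context {R : realType}.
Implicit Types (x y : R).
Local Notation MR := (measurableTypeR R).
Local Notation I := (`](- pi)%R, pi[%classic : set MR).

Let pi0 : (pi : R) != 0. Proof. by rewrite gt_eqF ?pi_gt0. Qed.

Let pi2 : 0 < 2 * (pi : R). Proof. by rewrite mulr_gt0// pi_gt0. Qed.

Let abs_cases (x : R) : (0 <= x /\ `|x| = x) \/ (x <= 0 /\ `|x| = - x).
Proof.
have [h|/ltW h] := leP 0 x; [left|right]; split => //.
  exact: ger0_norm.
exact: ler0_norm.
Qed.

Let II y : I y -> - pi < y < pi. Proof. by rewrite /= in_itv. Qed.

(** The linear term and the kink each have slope at most 1/2 in absolute value. *)
Lemma green_sub_le x x' y : I y -> green x y - green x' y <= `|x - x'|.
Proof.
move=> /II yI; rewrite /green.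
have -> : - (x * y) / (2 * pi) - `|x - y| / 2 + pi / 2 -
  (- (x' * y) / (2 * pi) - `|x' - y| / 2 + pi / 2) =
  (x' - x) * (y / (2 * pi)) + (`|x' - y| - `|x - y|) / 2.
  by move: pi0; move: pi => p p0; field; exact: p0.
have h1 : (x' - x) * (y / (2 * pi)) <= `|x - x'| / 2.
  rewrite (le_trans (ler_norm _))// normrM distrC; apply: ler_wpM2l => //.
  rewrite normrM (gtr0_norm (_ : 0 < (2 * pi)^-1)) ?invr_gt0//.
  by rewrite ler_pdivrMr// ler_norml; apply/andP; split; lra.
have : `|x' - y| <= `|x' - x| + `|x - y| by exact: ler_distD.
rewrite (distrC x' x); lra.
Qed.

Lemma green_bounded x : [bounded green x y | y in I].
Proof.
exists (`|x| + pi + pi); split; first exact: num_real.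
move=> M ltM y /II yI; apply: le_trans _ (ltW ltM) => /=.
rewrite /green.
have p0 : 0 < (pi : R) by exact: pi_gt0.
have h1 : `|- (x * y) / (2 * pi)| <= `|x| / 2.
  rewrite !normrM normrN normrM (gtr0_norm (_ : 0 < (2 * pi)^-1)) ?invr_gt0//.
  rewrite ler_pdivrMr// -mulrA; apply: ler_wpM2l => //.
  by rewrite ler_norml; apply/andP; split; lra.
have h2 : `|x - y| <= `|x| + pi.
  apply: le_trans (ler_normB _ _) _; rewrite lerD2l ler_norml.
  by apply/andP; split; lra.
move: h1; rewrite ler_norml => /andP[]; move: (- _ / _) => z h3 h4.
by have := normr_ge0 (x - y); rewrite ler_norml => ?; apply/andP; split; lra.
Qed.

Lemma measurable_green x : measurable_fun setT (green x : MR -> R).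
Proof.
apply: (@lipschitz_with_measurable R (`|x| / (2 * pi) + 2^-1)) => y y'; rewrite /green.
have -> : - (x * y) / (2 * pi) - `|x - y| / 2 + pi / 2 -
  (- (x * y') / (2 * pi) - `|x - y'| / 2 + pi / 2) =
  - (x / (2 * pi) * (y - y')) + (`|x - y'| - `|x - y|) / 2.
  by move: pi0; move: pi => p p0; field; exact: p0.
apply: le_trans (ler_normD _ _) _; rewrite [leRHS]mulrDl; apply: lerD.
  by rewrite normrN !normrM (gtr0_norm (_ : 0 < (2 * pi)^-1)) ?invr_gt0.
rewrite normrM (gtr0_norm (_ : 0 < 2^-1)) ?invr_gt0// mulrC ler_pM2l ?invr_gt0//.
apply: le_trans (ler_dist_dist _ _) _.
by have -> : x - y' - (x - y) = y - y' by ring.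
Qed.

Lemma green_pi y : I y -> green pi y = 0.
Proof.
move=> /II yI; rewrite /green ger0_norm; last lra.
by move: pi0; move: pi => p p0; field; exact: p0.
Qed.

Lemma green_Npi y : I y -> green (- pi) y = 0.
Proof.
move=> /II yI; rewrite /green ler0_norm; last lra.
by move: pi0; move: pi => p p0; field; exact: p0.
Qed.

Lemma green_opp x y : green (- x) (- y) = green x y.
Proof. by rewrite /green mulrNN -opprD normrN. Qed.

Lemma green_concave x z c y : 0 <= c <= 1 ->
  c * green x y + (1 - c) * green z y <= green (c * x + (1 - c) * z) y.
Proof.
move=> /andP[c0 c1]; rewrite /green.
have : `|c * x + (1 - c) * z - y| <= c * `|x - y| + (1 - c) * `|z - y|.
  have -> : c * x + (1 - c) * z - y = c * (x - y) + (1 - c) * (z - y) by ring.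
  rewrite (le_trans (ler_normD _ _))// !normrM.
  by rewrite (ger0_norm c0) (ger0_norm (_ : 0 <= 1 - c)); lra.
have -> : - ((c * x + (1 - c) * z) * y) / (2 * pi) =
  c * (- (x * y) / (2 * pi)) + (1 - c) * (- (z * y) / (2 * pi)).
  by move: pi0; move: pi => p p0; field; exact: p0.
lra.
Qed.

(* The linear parts of the two difference quotients cancel, which leaves a
   trapezoid vanishing off [a, b] and equal to 1 on [a', b']. *)
Definition trapezoid (a a' b' b y : R) :=
  (green a' y - green a y) / (a' - a) + (green b' y - green b y) / (b - b').

(** Each difference quotient of the distance to [y] lies in [-1, 1], and equals 1 or -1 when [y] is
    to the left or to the right of its two nodes. The trapezoid is half the difference of two such
    quotients. *)
Lemma trapezoid_bounds (a a' b' b y : R) : a < a' -> a' <= b' -> b' < b ->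
  \1_(`[a', b']%classic) y <= trapezoid a a' b' b y <= \1_(`]a, b[%classic) y.
Proof.
move=> aa' a'b' b'b.
have x0 : 0 < a' - a by lra.
have y0 : 0 < b - b' by lra.
have -> : trapezoid a a' b' b y =
  ((`|b - y| - `|b' - y|) / (b - b') - (`|a' - y| - `|a - y|) / (a' - a)) / 2.
  by rewrite /trapezoid /green; move: pi0; move: pi => p p0; field; rewrite p0 !gt_eqF.
have slope p q : p < q -> [/\ - 1 <= (`|q - y| - `|p - y|) / (q - p) <= 1,
    y <= p -> (`|q - y| - `|p - y|) / (q - p) = 1 &
    q <= y -> (`|q - y| - `|p - y|) / (q - p) = - 1].
  move=> pq; have qp : 0 < q - p by lra.
  have n0 : q - p != 0 by rewrite gt_eqF.
  split.
  - rewrite ler_pdivlMr// ler_pdivrMr//.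
    have [[? ->]|[? ->]] := abs_cases (q - y); have [[? ->]|[? ->]] := abs_cases (p - y);
      by apply/andP; split; lra.
  - move=> yp; rewrite !ger0_norm; [|lra..].
    have -> : q - y - (p - y) = q - p by ring.
    exact: divff.
  - move=> qy; rewrite !ler0_norm; [|lra..].
    have -> : - (q - y) - - (p - y) = - (q - p) by ring.
    by rewrite mulNr divff.
have [/andP[A1 A2] A3 A4] := slope a a' aa'.
have [/andP[B1 B2] B3 B4] := slope b' b b'b.
rewrite !indicE !mem_setE !in_itv/=.
have [ya|ya] := leP y a.
  rewrite A3// B3; last lra.
  rewrite (_ : (a' <= y) = false)/=; last by apply/negbTE; rewrite -ltNge; lra.
  by apply/andP; split; lra.
have [yb|yb] := leP b y.
  rewrite A4; last lra.
  rewrite B4// (_ : (y <= b') = false) ?andbF/=; last by apply/negbTE; rewrite -ltNge; lra.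
  by apply/andP; split; lra.
have [ya'|ya'] := leP a' y; have [yb'|yb'] := leP y b'; rewrite /=.
- by rewrite A4// B3//; apply/andP; split; lra.
- by rewrite A4//; apply/andP; split; lra.
- by rewrite B3//; apply/andP; split; lra.
- lra.
Qed.

(** Adding the values at opposite points cancels the linear terms. What remains is nonnegative, and
    equals [s - r] when [y] lies strictly between [- r] and [r]. *)
Lemma green_drop (r s y : R) : 0 <= r -> r <= s ->
  (s - r) * \1_(`]- r, r[%classic) y <=
  green r y + green (- r) y - green s y - green (- s) y.
Proof.
move=> r0 rs; rewrite /green.
have -> : - (r * y) / (2 * pi) - `|r - y| / 2 + pi / 2 +
  (- (- r * y) / (2 * pi) - `|- r - y| / 2 + pi / 2) -
  (- (s * y) / (2 * pi) - `|s - y| / 2 + pi / 2) -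
  (- (- s * y) / (2 * pi) - `|- s - y| / 2 + pi / 2) =
  (`|s - y| + `|- s - y| - `|r - y| - `|- r - y|) / 2.
  by move: pi0; move: pi => p p0; field; exact: p0.
rewrite indicE mem_setE in_itv/=.
have [[? ->]|[? ->]] := abs_cases (s - y); have [[? ->]|[? ->]] := abs_cases (- s - y);
have [[? ->]|[? ->]] := abs_cases (r - y); have [[? ->]|[? ->]] := abs_cases (- r - y);
case: (boolP (- r < y < r)) => [/andP[? ?]|_] /=; lra.
Qed.

End green_kernel.

(** * Bounds on the potential inherited from pointwise bounds on the kernel *)

Section potential.
Context {R : realType} (mu : {measure set (measurableTypeR R) -> \bar R}).
Local Notation MR := (measurableTypeR R).
Local Notation I := (`](- pi)%R, pi[%classic : set MR).
Hypothesis muI : (mu I < +oo)%E.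
Hypothesis muCI : mu (~` I) = 0%E.
Local Notation u := (green_pot mu).

Let mI : measurable I. Proof. exact: measurable_itv. Qed.

Lemma measure_setI_supp (A : set MR) : measurable A -> mu (A `&` I) = mu A.
Proof.
move=> mA; rewrite -[in RHS](setUIDK A I) measureU0//.
- exact: measurableI.
- exact: measurableD.
- apply/eqP; rewrite eq_le measure_ge0 andbT -muCI.
  apply: le_measure; rewrite ?inE; [exact: measurableD|exact: measurableC|].
  by move=> x [].
Qed.

Lemma measure_fin (A : set MR) : measurable A -> mu A \is a fin_num.
Proof.
move=> mA; rewrite -measure_setI_supp// ge0_fin_numE//.
by apply: le_lt_trans muI; apply: le_measure; rewrite ?inE//; exact: measurableI.
Qed.

Lemma green_integrable x : mu.-integrable I (EFin \o green x).
Proof.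
apply: measurable_bounded_integrable => //.
  by apply: measurable_funTS; exact: measurable_green.
exact: green_bounded.
Qed.

Let integrable_EFinZl k (g : MR -> R) : mu.-integrable I (EFin \o g) ->
  mu.-integrable I (EFin \o (fun y => k * g y)).
Proof.
move=> ig; rewrite (_ : EFin \o _ = fun y => k%:E * (EFin \o g) y)%E//.
exact: integrableZl.
Qed.

(** A list of pairs (coefficient, node) encodes a linear combination of kernels, so that
    integrability and linearity are proved once for all the combinations used below. *)
Lemma potential_sum (s : seq (R * R)) :
  mu.-integrable I (EFin \o (fun y => \sum_(p <- s) p.1 * green p.2 y)) /\
  \int[mu]_(y in I) (\sum_(p <- s) p.1 * green p.2 y) = \sum_(p <- s) p.1 * u p.2.
Proof.
elim: s => [|p s [ints IH]].
  rewrite (_ : (fun _ => _) = cst 0); last by apply/funext => y; rewrite big_nil.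
  split; first exact: (@integrable0 _ _ _ mu I).
  by rewrite big_nil (Rintegral_cst mu mI 0) mul0r.
have intp : mu.-integrable I (EFin \o (fun y => p.1 * green p.2 y)).
  by apply: integrable_EFinZl; exact: green_integrable.
rewrite (_ : (fun _ => _) =
    (fun y => p.1 * green p.2 y + \sum_(p <- s) p.1 * green p.2 y)); last first.
  by apply/funext => y; rewrite big_cons.
split.
  exact: (@integrableD _ _ _ mu I mI _ _ intp ints).
rewrite RintegralD// IH big_cons RintegralZl//; exact: green_integrable.
Qed.

Let indic_integrable k (B : set MR) : measurable B ->
  mu.-integrable I (EFin \o (fun y => k * \1_B y)) /\
  \int[mu]_(y in I) (k * \1_B y) = k * fine (mu B).
Proof.
move=> mB.
have i1 : mu.-integrable I (EFin \o \1_B).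
  apply: measurable_bounded_integrable => //.
  exists 1; split; first exact: num_real.
  move=> M M1 y _ /=; rewrite indicE; case: (_ \in _); rewrite ?normr1 ?normr0; lra.
split; first exact: integrable_EFinZl.
by rewrite RintegralZl// /Rintegral integral_indic// measure_setI_supp.
Qed.

(** Integration of a kernel inequality against [mu]. The Lipschitz bound, quasiconcavity, the slope
    bounds and the drop estimate all follow from this lemma or its mirror [potential_ge]. *)
Lemma potential_le (s : seq (R * R)) k (B : set MR) : measurable B ->
  (forall y, I y -> \sum_(p <- s) p.1 * green p.2 y <= k * \1_B y) ->
  \sum_(p <- s) p.1 * u p.2 <= k * fine (mu B).
Proof.
move=> mB sB; have [ints <-] := potential_sum s; have [iB <-] := indic_integrable k mB.
exact: le_Rintegral.
Qed.

Lemma potential_ge (s : seq (R * R)) k (B : set MR) : measurable B ->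
  (forall y, I y -> k * \1_B y <= \sum_(p <- s) p.1 * green p.2 y) ->
  k * fine (mu B) <= \sum_(p <- s) p.1 * u p.2.
Proof.
move=> mB sB; have [ints <-] := potential_sum s; have [iB <-] := indic_integrable k mB.
exact: le_Rintegral.
Qed.

Lemma potential_lip : lipschitz_with (fine (mu setT)) u.
Proof.
have key x x' : u x - u x' <= fine (mu setT) * `|x - x'|.
  have := @potential_le [:: (1, x); (- 1, x')] `|x - x'| setT measurableT.
  rewrite !big_cons big_nil/= addr0 mul1r mulN1r mulrC; apply => y Iy.
  rewrite !big_cons big_nil/= addr0 mul1r mulN1r indicT mulr1.
  exact: green_sub_le.
move=> x x'; rewrite ler_norml key andbT lerNl opprB (le_trans (key _ _))//.
by rewrite distrC.
Qed.

Let pot0 x : (forall y, I y -> green x y = 0) -> u x = 0.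
Proof.
move=> H; rewrite /green_pot integral0_eq//= => y Iy; by rewrite H.
Qed.

Lemma potential_pi : u pi = 0.
Proof. by apply: pot0 => y; exact: green_pi. Qed.

Lemma potential_Npi : u (- pi) = 0.
Proof. by apply: pot0 => y; exact: green_Npi. Qed.

Lemma potential_qconcave x y z t : x <= y -> y <= z -> t <= u x -> t <= u z -> t <= u y.
Proof.
move=> xy yz tx tz.
have [xz|xz] := eqVneq x z; first by have -> : y = x by lra.
have xz0 : 0 < z - x by rewrite subr_gt0 lt_neqAle xz (le_trans xy).
pose c := (z - y) / (z - x).
have c0 : 0 <= c by rewrite divr_ge0//; lra.
have c1 : c <= 1 by rewrite ler_pdivrMr//; lra.
have yE : y = c * x + (1 - c) * z by rewrite /c; field; rewrite gt_eqF.
(* With factor 0 on the right this is concavity of the potential, read off from concavity of the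
   kernel. *)
have := @potential_le [:: (c, x); (1 - c, z); (- 1, y)] 0 setT measurableT.
rewrite !big_cons big_nil/= addr0 mulN1r mul0r => H.
have {}H : c * u x + ((1 - c) * u z - u y) <= 0.
  apply: H => w Iw; rewrite !big_cons big_nil/= addr0 mulN1r mul0r.
  have := @green_concave _ x z c w; rewrite -yE c0 c1 => /(_ isT).
  by rewrite addrA subr_le0.
have : c * t <= c * u x by apply: ler_wpM2l.
have : (1 - c) * t <= (1 - c) * u z by apply: ler_wpM2l; lra.
lra.
Qed.

Let trapE (a a' b' b y : R) : trapezoid a a' b' b y =
  \sum_(p <- [:: ((a' - a)^-1, a'); (- (a' - a)^-1, a);
                 ((b - b')^-1, b'); (- (b - b')^-1, b)]) p.1 * green p.2 y.
Proof.
rewrite !big_cons big_nil/= /trapezoid.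
by rewrite addr0 !mulNr ![in RHS](mulrC _^-1) addrA -!mulrBl.
Qed.

Let trap_pot (a a' b' b : R) : (u a' - u a) / (a' - a) + (u b' - u b) / (b - b') =
  \sum_(p <- [:: ((a' - a)^-1, a'); (- (a' - a)^-1, a);
                 ((b - b')^-1, b'); (- (b - b')^-1, b)]) p.1 * u p.2.
Proof.
rewrite !big_cons big_nil/=.
by rewrite addr0 !mulNr ![in RHS](mulrC _^-1) addrA -!mulrBl.
Qed.

Lemma potential_slopes_le (a a' b' b : R) : a < a' -> a' <= b' -> b' < b ->
  (u a' - u a) / (a' - a) + (u b' - u b) / (b - b') <= fine (mu `]a, b[%classic).
Proof.
move=> aa' a'b' b'b; rewrite trap_pot -[leRHS]mul1r.
apply: potential_le => [|y _]; first exact: measurable_itv.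
by rewrite -trapE mul1r; have /andP[] := trapezoid_bounds y aa' a'b' b'b.
Qed.

(** The lower trapezoid bound; together with the upper one it recovers the measure from its
    potential. *)
Lemma potential_slopes_ge (a a' b' b : R) : a < a' -> a' <= b' -> b' < b ->
  fine (mu `[a', b']%classic) <= (u a' - u a) / (a' - a) + (u b' - u b) / (b - b').
Proof.
move=> aa' a'b' b'b; rewrite trap_pot -[leLHS]mul1r.
apply: potential_ge => [|y _]; first exact: measurable_itv.
by rewrite -trapE mul1r; have /andP[] := trapezoid_bounds y aa' a'b' b'b.
Qed.

Lemma potential_drop (r s : R) : 0 <= r -> r <= s ->
  (s - r) * fine (mu `]- r, r[%classic) <= u r + u (- r) - u s - u (- s).
Proof.
move=> r0 rs.
have := @potential_ge [:: (1, r); (1, - r); (- 1, s); (- 1, - s)] (s - r)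
  `]- r, r[%classic (measurable_itv _).
rewrite !big_cons big_nil/= !mul1r !mulN1r addr0 !addrA; apply => y _.
by rewrite !big_cons big_nil/= !mul1r !mulN1r addr0; have := green_drop y r0 rs; lra.
Qed.

(** Change of variables under the reflection, which preserves both the measure and, applied to both
    arguments, the kernel. *)
Lemma potential_even : (forall A : set MR, measurable A -> mu [set x : R | A (- x)] = mu A) ->
  forall x, u (- x) = u x.
Proof.
move=> muN x; rewrite /green_pot; congr fine.
have NI : [set x : R | I (- x)] = I.
  by apply/seteqP; split => y /=; rewrite !in_itv/= => /andP[? ?]; apply/andP; split; lra.
pose opp : MR -> MR := fun x : R => - x.
have mopp : measurable_fun setT opp by exact: oppr_measurable.
transitivity (\int[pushforward mu opp]_(y in I) (green (- x) y)%:E)%E.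
  by apply: eq_measure_integral => A mA _; rewrite /pushforward -muN.
rewrite integral_pushforward//.
- rewrite [opp @^-1` _]NI; apply: eq_integral => y _ /=; congr EFin.
  by rewrite -[in RHS]green_opp.
- by apply/measurable_EFinP; exact: measurable_green.
- rewrite [opp @^-1` _]NI; apply: eq_integrable (green_integrable x) => // y _ /=.
  by rewrite -[in LHS]green_opp.
Qed.

End potential.

Lemma measure_bigcup_le d (T : measurableType d) (R : realType)
    (mu : {measure set T -> \bar R}) (A : (set T)^nat) (c : \bar R) :
  (forall n, measurable (A n)) -> nondecreasing_seq A ->
  (forall n, (mu (A n) <= c)%E) -> (mu (\bigcup_n A n) <= c)%E.
Proof.
move=> mA ndA Ac; apply: (cvge_le _ (nondecreasing_cvg_mu mA _ ndA)).
  by apply: nearW => n; exact: Ac.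
exact: bigcup_measurable.
Qed.

Lemma itvoo_bigcupcc (R : realType) (a b : R) :
  `]a, b[%classic = \bigcup_n `[a + n.+1%:R^-1, b - n.+1%:R^-1]%classic.
Proof.
apply/seteqP; split => x /=; last first.
  move=> [n _]; rewrite /= !in_itv/=.
  have : (0 : R) < n.+1%:R^-1 by rewrite invr_gt0.
  by move: (_^-1) => e e0 /andP[? ?]; apply/andP; split; lra.
rewrite in_itv/= => /andP[ax xb].
pose d := Num.min (x - a) (b - x).
have d0 : 0 < d by rewrite lt_min; apply/andP; split; lra.
have [dx db] : d <= x - a /\ d <= b - x by split; rewrite ge_min lexx ?orbT.
exists (truncn d^-1) => //=; rewrite in_itv/=.
have : (truncn d^-1).+1%:R^-1 < d.
  by rewrite invf_plt ?posrE// truncnS_gt.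
by move: ((truncn _).+1%:R^-1) => e ?; apply/andP; split; lra.
Qed.

Lemma nondecreasing_itvcc (R : realType) (a b : R) :
  nondecreasing_seq (fun n => `[a + n.+1%:R^-1, b - n.+1%:R^-1]%classic).
Proof.
move=> m n mn; apply/subsetPset => x /=; rewrite !in_itv/=.
have : (n.+1%:R^-1 : R) <= m.+1%:R^-1 by rewrite lef_pV2 ?posrE// ler_nat.
move: (n.+1%:R^-1) (m.+1%:R^-1) => e e' ? /andP[? ?].
by apply/andP; split; lra.
Qed.

(** * A measure is determined by its potential *)

Section uniqueness.
Context {R : realType}.
Local Notation MR := (measurableTypeR R).
Local Notation I := (`](- pi)%R, pi[%classic : set MR).

(** For closed intervals exhausting ]a, b[, the mass under [mu] is at most a difference of chord
    slopes of the common potential, which is at most the mass of ]a, b[ under [nu]. *)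
Let potential_eq_le (mu nu : {measure set MR -> \bar R}) (a b : R) :
  (mu I < +oo)%E -> mu (~` I) = 0%E -> (nu I < +oo)%E -> nu (~` I) = 0%E ->
  (forall x, - pi <= x <= pi -> green_pot mu x = green_pot nu x) ->
  - pi <= a -> b <= pi -> (mu `]a, b[%classic <= nu `]a, b[%classic)%E.
Proof.
move=> muI muCI nuI nuCI uv pia bpi; rewrite [in leLHS]itvoo_bigcupcc.
apply: measure_bigcup_le => [n||n]; first exact: measurable_itv.
  exact: nondecreasing_itvcc.
set e := _^-1; have e0 : 0 < e by rewrite invr_gt0.
have [h|h] := leP (a + e) (b - e); last first.
  by rewrite set_itv_ge ?measure0// bnd_simp -ltNge.
have aa' : a < a + e by lra.
have bb' : b - e < b by lra.
have := le_trans (potential_slopes_ge muI muCI aa' h bb').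
rewrite !uv; [|apply/andP; split; lra..].
move=> /(_ _ (potential_slopes_le nuI nuCI aa' h bb')).
rewrite -lee_fin !fineK//; [apply: measure_fin|apply: measure_fin] => //;
  exact: measurable_itv.
Qed.

(** Open intervals are stable under intersection and generate the Borel sets, so equality on them
    suffices. They are first cut to ]-pi, pi[, where the potentials are known to agree. *)
Lemma potential_inj (mu nu : {measure set MR -> \bar R}) :
  (mu I < +oo)%E -> mu (~` I) = 0%E -> (nu I < +oo)%E -> nu (~` I) = 0%E ->
  (forall x, - pi <= x <= pi -> green_pot mu x = green_pot nu x) ->
  forall A, measurable A -> mu A = nu A.
Proof.
move=> muI muCI nuI nuCI uv.
apply: (@measure_unique _ R MR (@RGenOpens.G R) (fun n => `](- n%:R)%R, n%:R[%classic)).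
- exact: RGenOpens.measurableE.
- move=> _ _ [a [b ->]] [a' [b' ->]]; exists (Num.max a a'), (Num.min b b').
  apply/seteqP; split => x /=; rewrite !in_itv/= gt_max lt_min.
    by move=> [/andP[-> ->] /andP[-> ->]].
  by move=> /andP[/andP[-> ->] /andP[-> ->]].
- by move=> i; exists (- i%:R), i%:R.
- exact: bigcup_itvT.
- move=> _ [a [b ->]].
  have mab : measurable (`]a, b[%classic : set MR) by exact: measurable_itv.
  rewrite -(measure_setI_supp muCI mab) -(measure_setI_supp nuCI mab).
  have -> : `]a, b[ `&` I = `](Num.max a (- pi)), (Num.min b pi)[%classic.
    apply/seteqP; split => x /=; rewrite !in_itv/= gt_max lt_min.
      by move=> [/andP[-> ->] /andP[-> ->]].
    by move=> /andP[/andP[-> ->] /andP[-> ->]].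
  have pa : - pi <= Num.max a (- pi) by rewrite le_max lexx orbT.
  have pb : Num.min b pi <= pi by rewrite ge_min lexx orbT.
  apply/eqP; rewrite eq_le; apply/andP; split; apply: potential_eq_le => // x px.
  by rewrite uv.
- move=> k; rewrite -ge0_fin_numE//; apply: measure_fin => //; exact: measurable_itv.
Qed.

End uniqueness.

(** * Rearrangements *)

Section layer_cake.
Context {R : realType}.
Local Notation lam := (@lebesgue_measure R).
Local Notation MR := (measurableTypeR R).

Let subgraph (g : R -> R) : set (MR * MR) := [set p | 0 <= p.2 < g p.1].

Let measurable_subgraph (g : MR -> R) : measurable_fun setT g -> measurable (subgraph g).
Proof.
move=> mg.
rewrite (_ : subgraph g =
  (snd @^-1` `[0, +oo[) `&` ((fun p => p.2 < g p.1) @^-1` [set true])).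
  apply: measurableI.
    by rewrite -[X in measurable X]setTI; exact: measurable_snd.
  rewrite -[X in measurable X]setTI.
  apply: measurable_fun_ltr => //; exact: measurableT_comp.
apply/seteqP; split => p /=; rewrite in_itv/= andbT.
  by move=> /andP[].
by move=> [? ?]; apply/andP.
Qed.

(** Layer cake by Fubini-Tonelli on the region under the graph: vertical sections have length [f x],
    horizontal ones are superlevel sets. Extension by 0 gives empty vertical sections off [D]. *)
Lemma integral_subgraph (D : set R) (f : R -> R) :
  measurable D -> measurable_fun D f -> (forall x, D x -> 0 <= f x) ->
  [/\ measurable (subgraph (f \_ D)),
   (\int[lam]_(x in D) (f x)%:E = \int[lam]_t lam (ysection (subgraph (f \_ D)) t))%E &
   forall t, ysection (subgraph (f \_ D)) t = [set x | D x /\ 0 <= t < f x]].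
Proof.
move=> mD mf f0.
have mS : measurable (subgraph (f \_ D)).
  by apply: measurable_subgraph; apply/(measurable_restrictT _ mD).
split=> //.
- have := @indic_fubini_tonelli _ _ MR MR R lam lam _ mS.
  rewrite indic_fubini_tonelli_FE// indic_fubini_tonelli_GE//= => <-.
  rewrite integral_mkcond; apply: eq_integral => x _.
  rewrite restrict_EFin/=.
  rewrite (_ : xsection _ x = `[0, (f \_ D) x[%classic); last first.
    by apply/seteqP; split => t; rewrite /xsection/= inE /subgraph/= in_itv/=.
  rewrite lebesgue_measure_itv/= lte_fin.
  case: ltP => [_|]; first by rewrite sube0.
  move=> g0; apply/eqP; rewrite eqe eq_le g0/= patchE.
  by case: ifPn => // /set_mem; exact: f0.
- move=> t; apply/seteqP; split => x; rewrite /ysection/= inE /subgraph/= patchE.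
    by case: ifPn => [/set_mem//|_ /andP[t0 /(le_lt_trans t0)]]; rewrite ltxx.
  by move=> [Dx tf]; rewrite mem_set.
Qed.

Lemma le_integral_superlevel (D1 D2 : set R) (f g : R -> R) :
  measurable D1 -> measurable_fun D1 f -> (forall x, D1 x -> 0 <= f x) ->
  measurable D2 -> measurable_fun D2 g -> (forall x, D2 x -> 0 <= g x) ->
  (forall t, 0 <= t ->
     (lam [set x | D1 x /\ (t < f x)%R] <= lam [set x | D2 x /\ (t < g x)%R])%E) ->
  (\int[lam]_(x in D1) (f x)%:E <= \int[lam]_(x in D2) (g x)%:E)%E.
Proof.
move=> mD1 mf f0 mD2 mg g0 fg.
have [m1 -> e1] := integral_subgraph mD1 mf f0.
have [m2 -> e2] := integral_subgraph mD2 mg g0.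
apply: ge0_le_integral => //.
- by apply: (measurable_fun_ysection lam m1).
- by apply: (measurable_fun_ysection lam m2).
- move=> t _; rewrite e1 e2.
  have [t0|t0] := leP 0 t; first exact: fg.
  rewrite (_ : [set x | _] = set0) ?measure0//.
  by rewrite -subset0 => x /= [].
Qed.

End layer_cake.

Section interval_measure.
Context {R : realType}.
Local Notation lam := (@lebesgue_measure R).

Lemma lebesgue_measure_itv_le (x y : R) b1 b2 : x <= y ->
  lam [set` Interval (BSide b1 x) (BSide b2 y)] = (y - x)%:E.
Proof.
move=> xy; rewrite lebesgue_measure_itv/= lte_fin.
case: ltP => [//|yx]; have -> : y = x by lra.
by rewrite subrr.
Qed.

Lemma lebesgue_measureD1 (A : set (measurableTypeR R)) (r : R) : measurable A ->
  (lam A <= lam (A `\ r))%E.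
Proof.
move=> mA; have m1 : measurable ([set r] : set (measurableTypeR R)) by exact: measurable_set1.
rewrite -(measureU0 (mu := lam) (A := A `\ r) (B := [set r]))//.
- apply: le_measure; rewrite ?inE//; first by apply: measurableU => //; exact: measurableD.
  by move=> x Ax; have [->|/eqP xr] := eqVneq x r; [right|left].
- exact: measurableD.
- exact: lebesgue_measure_set1.
Qed.

End interval_measure.

(** * The symmetric decreasing rearrangement through its distribution function *)

Section rearrangement.
Context {R : realType} (f : R -> R).
Local Notation MR := (measurableTypeR R).
Local Notation lam := (@lebesgue_measure R).
Local Notation I := (`](- pi)%R, pi[%classic : set MR).
Local Notation D := (`[(- pi)%R, pi]%classic : set MR).
Hypothesis mf : measurable_fun D f.
Hypothesis f0 : forall x, D x -> 0 <= f x.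
Hypothesis intf : lam.-integrable D (EFin \o f).

Let pi0 : (0 : R) < pi. Proof. exact: pi_gt0. Qed.
Let mD : measurable D. Proof. exact: measurable_itv. Qed.
Let mI : measurable I. Proof. exact: measurable_itv. Qed.

Let S t := [set x | D x /\ t < f x].
Let d t := lam (S t).

Let mS t : measurable (S t).
Proof.
rewrite (_ : S t = D `&` f @^-1` `]t, +oo[%classic); first exact: mf.
by apply/seteqP; split => x [Dx h]; split => //; move: h; rewrite /= in_itv/= andbT.
Qed.

Let lamD : lam D = (2 * pi)%:E.
Proof.
rewrite lebesgue_measure_itv_le; first by rewrite opprK mulr_natl mulr2n.
by rewrite (le_trans _ (ltW pi0))// oppr_le0 ltW.
Qed.

Let d_le t : (d t <= (2 * pi)%:E)%E.
Proof. by rewrite -lamD; apply: le_measure; rewrite ?inE// => x []. Qed.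

Let d_fin t : d t \is a fin_num.
Proof. by rewrite ge0_fin_numE// (le_lt_trans (d_le t))// ltry. Qed.

Let d_nincr t t' : t <= t' -> (d t' <= d t)%E.
Proof.
move=> tt'; apply: le_measure; rewrite ?inE// => x [Dx h]; split => //.
exact: le_lt_trans h.
Qed.

(** Right continuity of the distribution function: [S t] is the increasing union of the sets
    [S (t + n.+1%:R^-1)]. *)
Let d_right t r : (r%:E < d t)%E -> exists2 t', t < t' & (r%:E < d t')%E.
Proof.
move=> rd; apply: contrapT => H; move: rd; apply/negP; rewrite -leNgt /d.
have -> : S t = \bigcup_n S (t + n.+1%:R^-1).
  apply/seteqP; split => x.
    move=> [Dx tx]; exists (truncn (f x - t)^-1) => //; split => //.
    rewrite -ltrBDl invf_plt ?posrE ?truncnS_gt//; lra.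
  move=> [n _ [Dx tx]]; split => //; apply: lt_trans tx.
  by rewrite ltrDl invr_gt0.
apply: measure_bigcup_le => [//||n].
  move=> m n mn; apply/subsetPset => x [Dx tx]; split => //.
  by apply: le_lt_trans tx; rewrite lerD2l lef_pV2 ?posrE// ler_nat.
rewrite leNgt; apply/negP => h; apply: H; exists (t + n.+1%:R^-1) => //.
by rewrite ltrDl invr_gt0.
Qed.

Let sym_rearrE x : 0 < `|x| -> `|x| < pi ->
  sym_rearr f x = ereal_inf [set t%:E | t in [set t | (d t <= (2 * `|x|)%:E)%E]].
Proof.
move=> x0 xpi; rewrite /sym_rearr /decr_rearr.
by rewrite gt_eqF ?mulr_gt0// lt_eqF// ltr_pM2l.
Qed.

(** The direction from the measure to the rearrangement needs right continuity: [d_right] yields a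
    [t'] above [t] that still bounds from below every element of the set whose infimum is taken. *)
Lemma sym_rearr_gt x t : 0 < `|x| -> `|x| < pi ->
  ((t%:E < sym_rearr f x) = ((2 * `|x|)%:E < lam [set y | D y /\ (t < f y)%R]))%E.
Proof.
move=> x0 xpi; rewrite sym_rearrE//; apply/idP/idP.
  move=> h; rewrite ltNge; apply/negP => dt.
  move: h; apply/negP; rewrite -leNgt; apply: ereal_inf_lbound.
  by exists t.
move=> /d_right[t' tt' dt']; apply: (@lt_le_trans _ _ t'%:E); first by rewrite lte_fin.
apply: le_ereal_inf_tmp => _ [r dr <-]; rewrite lee_fin leNgt; apply/negP => rt'.
by have := le_lt_trans (le_trans (d_nincr (ltW rt')) dr) dt'; rewrite ltxx.
Qed.

Let sym_rearr_ge0 x : 0 < `|x| -> `|x| < pi -> (0 <= sym_rearr f x)%E.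
Proof.
move=> x0 xpi; rewrite sym_rearrE//; apply: le_ereal_inf_tmp => _ [r dr <-].
rewrite lee_fin leNgt; apply/negP => r0; move: dr => /=; rewrite /d.
have -> : S r = D.
  apply/seteqP; split => [x' []//|x' Dx']; split => //; exact: lt_le_trans (f0 Dx').
by rewrite lamD lee_fin; lra.
Qed.

(** By Markov's inequality, [a * d a] is at most the integral [c] of [f], so a large enough [a]
    belongs to the set whose infimum defines the rearrangement. *)
Let sym_rearr_fin x : 0 < `|x| -> `|x| < pi -> sym_rearr f x \is a fin_num.
Proof.
move=> x0 xpi; rewrite ge0_fin_numE; last exact: sym_rearr_ge0.
have ffin : (\int[lam]_(x in D) `|(f x)%:E| < +oo)%E by case/integrableP: intf.
have : (\int[lam]_(x in D) `|(f x)%:E|)%E \is a fin_num.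
  by rewrite ge0_fin_numE//; exact: integral_ge0.
move=> /fineK; set c := fine _ => cE.
have c0 : 0 <= c by rewrite fine_ge0// integral_ge0.
(* The quotient gives [c <= a * (2 * |x|)]; the added 1 keeps [a] positive when [c = 0]. *)
pose a := c / (2 * `|x|) + 1.
have q0 : 0 <= c / (2 * `|x|) by rewrite divr_ge0// mulr_ge0.
have a0 : 0 < a by rewrite /a; lra.
apply: (@le_lt_trans _ _ a%:E); last exact: ltry.
rewrite sym_rearrE//; apply: ereal_inf_lbound; exists a => //=.
have := @le_integral_abse _ _ _ lam D mD (EFin \o f) a _ a0.
rewrite -cE => /(_ ltac:(exact/measurable_EFinP)) h.
have h2 : (a%:E * d a <= c%:E)%E.
  apply: le_trans h; apply: lee_pmul => //; first by rewrite lee_fin ltW.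
  apply: le_measure; rewrite ?inE//.
    by apply: emeasurable_fun_c_infty => //; apply: measurableT_comp => //; exact/measurable_EFinP.
  move=> y [Dy ay]; split => //=; rewrite lee_fin ger0_norm ?f0//; exact: ltW.
move: h2; rewrite -(fineK (d_fin a)) -EFinM !lee_fin => h2.
rewrite -(ler_pM2l a0) (le_trans h2)//.
rewrite /a mulrDl divfK ?gt_eqF ?mulr_gt0//; lra.
Qed.

(* Finite-valued version of [sym_rearr f], which may be infinite at 0. *)
Definition sym_rearr_real x : R := if x == 0 then 0 else fine (sym_rearr f x).

Lemma sym_rearr_realE x : I x -> x != 0 -> (sym_rearr_real x)%:E = sym_rearr f x.
Proof.
rewrite /= in_itv/= /sym_rearr_real => /andP[? ?] x0; rewrite (negPf x0) fineK//.
apply: sym_rearr_fin; rewrite ?normr_gt0//.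
by rewrite ltr_norml; apply/andP.
Qed.

Lemma sym_rearr_real_ge0 x : I x -> 0 <= sym_rearr_real x.
Proof.
move=> Ix; have [->|x0] := eqVneq x 0; first by rewrite /sym_rearr_real eqxx.
rewrite -lee_fin sym_rearr_realE//; apply: sym_rearr_ge0; rewrite ?normr_gt0//.
by move: Ix; rewrite /= in_itv/= => /andP[? ?]; rewrite ltr_norml; apply/andP.
Qed.

Lemma sym_rearr_realN x : sym_rearr_real (- x) = sym_rearr_real x.
Proof. by rewrite /sym_rearr_real oppr_eq0 /sym_rearr normrN. Qed.

(** Apart from the origin, the superlevel sets are centred open intervals cut to [I]. Measurability,
    the bound on the total mass and the Hardy-Littlewood inequality all rest on this description. *)
Lemma sym_rearr_real_gt x t : I x -> x != 0 ->
  (t < sym_rearr_real x) = (2 * `|x| < fine (lam [set y | D y /\ (t < f y)%R])).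
Proof.
move=> Ix x0; rewrite -lte_fin sym_rearr_realE// sym_rearr_gt ?normr_gt0//.
  by rewrite -/(S t) -/(d t) -[X in (_ < X)%E](fineK (d_fin t)) lte_fin.
by move: Ix; rewrite /= in_itv/= => /andP[? ?]; rewrite ltr_norml; apply/andP.
Qed.

Lemma measurable_sym_rearr_real : measurable_fun I sym_rearr_real.
Proof.
have m1 : measurable ([set 0] : set MR) by exact: measurable_set1.
(* The value at 0 is a convention that the description of superlevel sets does not cover, so 0 is
   split off. *)
have -> : I = (I `\ 0) `|` [set 0].
  rewrite setUC setDUK// => _ ->; have p0 := pi0; rewrite /= in_itv/=; apply/andP; split; lra.
apply/measurable_funU => //; first exact: measurableD.
split; last exact: measurable_fun_set1.
apply: (measurability (@RGenOInfty.G R)) => [|/= _ [_] [t] -> <-].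
  exact: RGenOInfty.measurableE.
pose e := fine (d t) / 2.
rewrite (_ : _ `&` _ = (I `\ 0) `&` `]- e, e[%classic).
  apply: measurableI; first exact: measurableD.
  exact: measurable_itv.
apply/seteqP; split => x /= [[Ix /eqP x0]]; rewrite !in_itv/= ?andbT sym_rearr_real_gt//.
  move=> h; split => //; first by split => //; exact/eqP.
  by rewrite -ltr_norml /e; lra.
rewrite -ltr_norml /e => h; split; first by split => //; exact/eqP.
lra.
Qed.

Lemma integral_sym_rearr_real (A : set MR) : measurable A ->
  (\int[lam]_(x in A `&` I) sym_rearr f x = \int[lam]_(x in A `&` I) (sym_rearr_real x)%:E)%E.
Proof.
move=> mA.
have mAI : measurable (A `&` I) by exact: measurableI.
have mg : measurable_fun I (EFin \o sym_rearr_real) by apply/measurable_EFinP; exact: measurable_sym_rearr_real.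
have aeq : ae_eq lam I (sym_rearr f) (EFin \o sym_rearr_real).
  exists [set 0]; split => //; first exact: lebesgue_measure_set1.
  move=> x /= h; apply: contrapT => /eqP x0; apply: h => Ix.
  by rewrite sym_rearr_realE.
have ms : measurable_fun I (sym_rearr f).
  have m1 : measurable ([set 0] : set MR) by exact: measurable_set1.
  have mI0 : measurable (I `\ 0) by exact: measurableD.
  rewrite (_ : I = (I `\ 0) `|` [set 0]); last first.
    rewrite setUC setDUK// => _ ->; have p0 := pi0; rewrite /= in_itv/=; apply/andP; split; lra.
  apply/measurable_funU => //; split; last exact: measurable_fun_set1.
  apply: (eq_measurable_fun (EFin \o sym_rearr_real)).
    by move=> x /set_mem[Ix /eqP x0] /=; rewrite sym_rearr_realE.
  by apply: measurable_funS mg => // x [].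
apply: ae_eq_integral => //.
- by apply: measurable_funS ms.
- by apply: measurable_funS mg.
- by apply: ae_eq_subset aeq.
Qed.

Lemma integral_sym_rearr_real_even (A : set MR) : measurable A ->
  (\int[lam]_(x in [set x : R | A (- x)%R] `&` I) (sym_rearr_real x)%:E =
   \int[lam]_(x in A `&` I) (sym_rearr_real x)%:E)%E.
Proof.
move=> mA.
have mAI : measurable (A `&` I) by exact: measurableI.
pose opp : MR -> MR := fun x : R => - x.
have mopp : measurable_fun setT opp by exact: oppr_measurable.
transitivity (\int[pushforward lam opp]_(x in A `&` I) (sym_rearr_real x)%:E)%E; last first.
  by apply: eq_measure_integral => B mB _; rewrite -[RHS]lebesgue_measureN.
rewrite (ge0_integral_pushforward mopp lam mAI).
- rewrite (_ : opp @^-1` _ = [set x : R | A (- x)] `&` I).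
    by apply: eq_integral => x _ /=; rewrite sym_rearr_realN.
  apply/seteqP; split => x /=; rewrite !in_itv/= /opp => -[? /andP[? ?]];
    by split => //; apply/andP; split; lra.
- by apply/measurable_EFinP; apply: measurable_funS measurable_sym_rearr_real.
- by move=> x /set_mem[_ Ix]; rewrite lee_fin sym_rearr_real_ge0.
Qed.

Lemma integral_sym_rearr_real_le :
  (\int[lam]_(x in I) (sym_rearr_real x)%:E <= \int[lam]_(x in D) (f x)%:E)%E.
Proof.
apply: le_integral_superlevel => //; first exact: measurable_sym_rearr_real.
  exact: sym_rearr_real_ge0.
move=> t t0; rewrite -/(S t) -/(d t) -(fineK (d_fin t)); set c := fine (d t).
have c0 : 0 <= c by rewrite fine_ge0.
rewrite (_ : c = c / 2 - - (c / 2)); last lra.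
rewrite -(@lebesgue_measure_itv_le _ _ _ false true); last lra.
apply: le_outer_measure => x [Ix tx]; have x0 : x != 0.
  by apply: contraTneq tx => ->; rewrite /sym_rearr_real eqxx -leNgt.
move: tx; rewrite sym_rearr_real_gt// -/(S t) -/(d t) -/c => tx.
by rewrite /= in_itv/= -ltr_norml; lra.
Qed.

(** By layer cake it suffices to compare superlevel sets. That of [f] in ]a, b[ has measure at most
    both [b - a] and [d t], hence at most [2 * m]; that of the rearrangement contains ]-m, m[ minus
    the origin. *)
Lemma hardy_littlewood_itv a b : - pi <= a -> a <= b -> b <= pi ->
  (\int[lam]_(x in `]a, b[) (f x)%:E <=
   \int[lam]_(x in `](- ((b - a) / 2))%R, ((b - a) / 2)%R[) (sym_rearr_real x)%:E)%E.
Proof.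
move=> pia ab bpi; set r := (b - a) / 2.
have abD : `]a, b[%classic `<=` D.
  by move=> x /=; rewrite !in_itv/= => /andP[? ?]; apply/andP; split; lra.
have rI : `](- r), r[%classic `<=` I.
  by move=> x /=; rewrite !in_itv/= /r => /andP[? ?]; apply/andP; split; lra.
apply: le_integral_superlevel.
- exact: measurable_itv.
- exact: measurable_funS mf.
- by move=> x /abD; exact: f0.
- exact: measurable_itv.
- by apply: measurable_funS measurable_sym_rearr_real.
- by move=> x /rI; exact: sym_rearr_real_ge0.
move=> t t0; set c := fine (d t).
have c0 : 0 <= c by rewrite fine_ge0.
pose m := Num.min r (c / 2).
have m0 : 0 <= m by rewrite le_min; apply/andP; split; rewrite /r; lra.
apply: (@le_trans _ _ (2 * m)%:E).
  rewrite /m minr_pMr// EFin_min le_min; apply/andP; split.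
    rewrite (_ : 2 * r = b - a); last by rewrite /r; lra.
    rewrite -(@lebesgue_measure_itv_le _ _ _ false true)//.
    by apply: le_outer_measure => x [].
  rewrite (_ : 2 * (c / 2) = c); last lra.
  rewrite fineK//.
  by apply: le_outer_measure => x [/abD].
rewrite (_ : 2 * m = m - - m); last lra.
rewrite -(@lebesgue_measure_itv_le _ _ _ false true); last lra.
apply: (@le_trans _ _ (lam (`]- m, m[ `\ 0))).
  by apply: lebesgue_measureD1; exact: measurable_itv.
apply: le_outer_measure => x [/=]; rewrite in_itv/= => /andP[h1 h2] /eqP x0.
have : `|x| < m by rewrite ltr_norml; apply/andP.
rewrite lt_min => /andP[xr xc].
have xr' : `](- r), r[%classic x by rewrite /= in_itv/= -ltr_norml.
split => //; rewrite sym_rearr_real_gt//; last exact: rI.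
by rewrite -/(S t) -/(d t) -/c; lra.
Qed.

End rearrangement.

(** * Superlevel sets of the potentials *)

Section superlevel_sets.
Context {R : realType} (L Ku Kv : R) (u v : R -> R).
Local Notation MR := (measurableTypeR R).
Local Notation lam := (@lebesgue_measure R).
Local Notation D := (`[(- L)%R, L]%classic : set MR).
Hypothesis L0 : 0 < L.

Let NLL : - L <= L. Proof. by have := L0; lra. Qed.

Lemma measurable_superlevel K w r : lipschitz_with K w ->
  measurable [set x : MR | D x /\ r <= w x].
Proof.
move=> wl; rewrite (_ : [set x | _] = D `&` w @^-1` `[r, +oo[%classic).
  apply: measurableI; first exact: measurable_itv.
  rewrite -[X in measurable X]setTI.
  by apply: (lipschitz_with_measurable wl) => //; exact: measurable_itv.
by apply/seteqP; split => x [Dx h]; split => //; move: h; rewrite /= in_itv/= andbT.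
Qed.

Lemma even_superlevel_ge (g : R -> R) x t :
  (forall x, D x -> g (- x) = g x) ->
  (forall r s, 0 <= r -> r <= s -> s <= L -> g s <= g r) ->
  0 <= x -> x <= L -> t <= g x -> ((2 * x)%:E <= lam [set y | D y /\ (t <= g y)%R])%E.
Proof.
move=> gN gni x0 xL tx.
rewrite (_ : 2 * x = x - - x); last lra.
rewrite -(@lebesgue_measure_itv_le _ _ _ true false); last lra.
apply: le_outer_measure => y; rewrite /= in_itv/= => /andP[h1 h2].
have Dy : D y by rewrite /= in_itv/=; apply/andP; split; lra.
split=> //; apply: le_trans tx _.
have [y0|y0] := leP 0 y; first by apply: gni.
by rewrite -[leRHS]gN//; apply: gni; lra.
Qed.

Lemma even_superlevel_le (g : R -> R) y t :
  (forall x, D x -> g (- x) = g x) ->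
  (forall r s, 0 <= r -> r <= s -> s <= L -> g s <= g r) ->
  0 <= y -> g y < t -> (lam [set x | D x /\ (t <= g x)%R] <= (2 * y)%:E)%E.
Proof.
move=> gN gni y0 ty.
rewrite (_ : 2 * y = y - - y); last lra.
rewrite -(@lebesgue_measure_itv_le _ _ _ true false); last lra.
apply: le_outer_measure => x [Dx tx]; rewrite /= in_itv/= -ler_norml leNgt; apply/negP => yx.
suff : g x <= g y by lra.
move: (Dx); rewrite /= in_itv/= => /andP[h1 h2].
have [x0|x0] := leP 0 x.
  by apply: gni => //; move: yx; rewrite ger0_norm// => /ltW.
by rewrite -gN//; apply: gni => //; move: yx; rewrite ltr0_norm//; lra.
Qed.

Hypothesis Ku0 : 0 <= Ku.
Hypothesis Kv0 : 0 <= Kv.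
Hypothesis u_lip : lipschitz_with Ku u.
Hypothesis v_lip : lipschitz_with Kv v.
Hypothesis uNL : u (- L) = 0.
Hypothesis uL : u L = 0.
Hypothesis u_ge0 : forall x, D x -> 0 <= u x.
Hypothesis vN : forall x, D x -> v (- x) = v x.
Hypothesis vL : v L = 0.
Hypothesis v_ni : forall r s, 0 <= r -> r <= s -> s <= L -> v s <= v r.
Hypothesis level_le : forall T a b, 0 <= T -> level_itv L u T a b -> T <= v ((b - a) / 2).

Let v_ge0 x : D x -> 0 <= v x.
Proof.
move=> Dx; have := Dx; rewrite /= in_itv/= => /andP[h1 h2].
have [x0|x0] := leP 0 x; first by rewrite -[leLHS]vL; apply: v_ni.
by rewrite -vN// -[leLHS]vL; apply: v_ni; lra.
Qed.

Let level_measure t a b : level_itv L u t a b ->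
  (lam [set x | D x /\ (t <= u x)%R] <= (b - a)%:E)%E.
Proof.
move=> [[La ab bL _ _] H].
rewrite -(@lebesgue_measure_itv_le _ _ _ true false)//.
apply: le_outer_measure => x [Dx tx]; rewrite /= in_itv/=.
exact: H.
Qed.

(** For a level that [u] attains, let [w] be half the length of the level interval: the bound
    [t <= v w] places [-w, w] inside the superlevel set of [v]. Levels at most 0 are trivial since
    [v] is nonnegative. *)
Lemma superlevel_le t :
  (lam [set x | D x /\ (t <= u x)%R] <= lam [set x | D x /\ (t <= v x)%R])%E.
Proof.
have [t0|t0] := leP t 0.
  apply: le_outer_measure => x [Dx _]; split => //; exact: le_trans (v_ge0 Dx).
have [[c [Dc tc]]|N] := pselect (exists c, D c /\ t <= u c); last first.
  rewrite [X in lam X](_ : _ = set0) ?measure0// -subset0 => x h.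
  by apply: N; exists x.
have cL : - L <= c <= L by move: Dc; rewrite /= in_itv.
have [||a [b [l _]]] := @level_itv_exists _ L Ku u c t Ku0 u_lip cL _ _ tc.
- by rewrite uNL ltW.
- by rewrite uL ltW.
apply: le_trans (level_measure l) _.
have [[La ab bL _ _] _] := l.
rewrite (_ : b - a = 2 * ((b - a) / 2)); last lra.
apply: even_superlevel_ge => //; [lra|lra|].
exact: level_le (ltW t0) l.
Qed.

(** A monotone function may jump, so its superlevel sets pull back to rays that can be open or
    closed. With [m] the infimum of the values of [u] in [S], the set is one closed superlevel set
    if [m] is in [S], and otherwise an increasing union of such sets. *)
Lemma upper_set_le (S : set R) : (forall y z, y <= z -> S y -> S z) ->
  (lam [set x | D x /\ S (u x)] <= lam [set x | D x /\ S (v x)])%E.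
Proof.
move=> upS.
pose A : set R := [set x | D x /\ S (u x)].
have [A0|/set0P[c Ac]] := eqVneq A set0; first by rewrite -/A A0 measure0.
have ray t : S t -> (lam [set x | D x /\ (t <= u x)%R] <= lam [set x | D x /\ S (v x)])%E.
  move=> St; apply: le_trans (superlevel_le t) _.
  by apply: le_outer_measure => x [Dx tx]; split => //; apply: upS St.
have lb : has_inf (u @` A).
  by split; [exists (u c), c | exists 0 => _ [x [Dx _] <-]; exact: u_ge0].
pose m := inf (u @` A).
have Am x : A x -> m <= u x.
  by move=> Ax; apply: ge_inf; [exact: lb.2 | exists x].
have [Sm|NSm] := pselect (S m).
  apply: le_trans (ray _ Sm); apply: le_outer_measure => x Ax; split; first exact: Ax.1.
  exact: Am.
have Sn n : S (m + n.+1%:R^-1).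
  have n0 : (0 : R) < n.+1%:R^-1 by rewrite invr_gt0.
  have [_ [x [_ Sx] <-] xm] := inf_adherent n0 lb.
  exact: upS (ltW xm) Sx.
rewrite -/A (_ : A = \bigcup_n [set x | D x /\ (m + n.+1%:R^-1 <= u x)%R]).
  apply: measure_bigcup_le => [n||n]; last exact: ray.
    exact: measurable_superlevel u_lip.
  move=> n k nk; apply/subsetPset => x [Dx tx]; split => //.
  by apply: le_trans tx; rewrite lerD2l lef_pV2 ?posrE// ler_nat.
apply/seteqP; split => [x Ax|x [n _ [Dx h]]]; last by split => //; apply: upS h (Sn n).
have mx : m < u x.
  by rewrite lt_neqAle Am// andbT; apply/eqP => mE; apply: NSm; rewrite mE; exact: Ax.2.
exists (truncn (u x - m)^-1) => //; split; first exact: Ax.1.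
rewrite -lerBrDl ltW// invf_plt ?posrE ?truncnS_gt//; lra.
Qed.

Section monotone_integrals.
Variable psi : R -> R.
Hypothesis psi_nd : forall x y, x <= y -> psi x <= psi y.

Lemma measurable_comp_lipschitz K w : lipschitz_with K w ->
  measurable_fun D (psi \o w : MR -> R).
Proof.
move=> w_lip; apply: (@measurableT_comp _ _ _ MR MR R psi).
  by apply: nondecreasing_measurable => // x y; exact: psi_nd.
by apply: measurable_funTS; exact: lipschitz_with_measurable w_lip.
Qed.

Lemma integrable_comp_lipschitz K w : lipschitz_with K w ->
  lam.-integrable D (EFin \o (psi \o w)).
Proof.
move=> w_lip; apply: measurable_bounded_integrable => //.
- by rewrite /= lebesgue_measure_itv_le; [exact: ltry|exact: NLL].
- exact: measurable_comp_lipschitz w_lip.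
pose M := `|w 0| + `|K| * L.
exists (`|psi (- M)| + `|psi M|); split; first exact: num_real.
move=> C MC x; rewrite /= in_itv/= => /andP[h1 h2]; apply: le_trans _ (ltW MC).
have : `|w x| <= M.
  have -> : w x = w 0 + (w x - w 0) by ring.
  apply: le_trans (ler_normD _ _) _; rewrite lerD2l (le_trans (w_lip _ _))//.
  rewrite subr0; apply: (@le_trans _ _ (`|K| * `|x|)).
    by apply: ler_wpM2r => //; exact: ler_norm.
  by apply: ler_wpM2l => //; rewrite ler_norml; apply/andP.
rewrite ler_norml => /andP[/psi_nd a1 /psi_nd a2].
have := ler_norm (psi M); have := ler_norm (- psi (- M)); rewrite normrN => b1 b2.
have c1 := normr_ge0 (psi M); have c2 := normr_ge0 (psi (- M)).
by rewrite /= ler_norml; apply/andP; split; lra.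
Qed.

(** Subtracting [psi 0] makes both integrands nonnegative, since [u] and [v] are; then the layer
    cake comparison applies with upper sets. *)
Lemma Rintegral_comp_le :
  \int[lam]_(x in D) psi (u x) <= \int[lam]_(x in D) psi (v x).
Proof.
have iu := integrable_comp_lipschitz u_lip; have iv := integrable_comp_lipschitz v_lip.
have ic : lam.-integrable D (EFin \o cst (psi 0)).
  by apply: measurable_bounded_integrable => //;
    [rewrite /= lebesgue_measure_itv_le; [exact: ltry|exact: NLL] | exact: bounded_cst].
have le w : (forall x, D x -> 0 <= w x) -> forall x, D x -> 0 <= psi (w x) - psi 0.
  by move=> w0 x Dx; rewrite subr_ge0 psi_nd ?w0.
have mcst : measurable_fun D (cst (psi 0)) by [].
suff : \int[lam]_(x in D) (psi (u x) - psi 0) <= \int[lam]_(x in D) (psi (v x) - psi 0).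
  by rewrite (RintegralB _ iu ic)// (RintegralB _ iv ic)//; lra.
apply: fine_le.
- by apply: integrable_fin_num => //; exact: (@integrableB _ _ _ lam D _ _ _ iu ic).
- by apply: integrable_fin_num => //; exact: (@integrableB _ _ _ lam D _ _ _ iv ic).
apply: le_integral_superlevel => //.
- by apply: measurable_funB => //; exact: measurable_comp_lipschitz u_lip.
- exact: le.
- by apply: measurable_funB => //; exact: measurable_comp_lipschitz v_lip.
- exact: le.
move=> t t0; apply: (@upper_set_le [set y | t < psi y - psi 0]) => y z yz /= ty.
by apply: lt_le_trans ty _; rewrite lerB// psi_nd.
Qed.

End monotone_integrals.

(** * The equality case: equimeasurability and coincidence of the potentials *)

Section equality.
Variable phi : R -> R.
Hypothesis phi_inc : forall x y, x < y -> phi x < phi y.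
Hypothesis phi_eq : \int[lam]_(x in D) phi (u x) = \int[lam]_(x in D) phi (v x).

Let phi_nd x y : x <= y -> phi x <= phi y.
Proof. by rewrite le_eqVlt => /predU1P[->//|/phi_inc/ltW]. Qed.

(* Both [phi] clamped to [t', t] and the remainder are nondecreasing, so each
   of their integrals has to agree. *)
Lemma superlevel_eq_le t' t : t' < t ->
  (lam [set x | D x /\ (t <= v x)%R] <= lam [set x | D x /\ (t' <= u x)%R])%E.
Proof.
move=> tt'.
pose cl (y : R) := Num.max t' (Num.min y t).
have cl_nd x y : x <= y -> cl x <= cl y.
  move=> xy; rewrite /cl ge_max !le_max lexx/=; apply/orP; right.
  by rewrite le_min !ge_min xy lexx orbT.
pose p1 y := phi (cl y).
pose p2 y := phi y - phi (cl y).
have p1_nd x y : x <= y -> p1 x <= p1 y by move=> /cl_nd/phi_nd.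
have cl_low y : y <= t' -> cl y = t'.
  by move=> yt; apply/max_idPl; rewrite ge_min yt.
have cl_mid y : t' <= y -> y <= t -> cl y = y.
  by move=> h1 h2; rewrite /cl (min_idPl h2); exact/max_idPr.
have cl_high y : t <= y -> cl y = t.
  by move=> h; rewrite /cl (min_idPr h); apply/max_idPr; exact: ltW.
(* The remainder is [phi y - phi t'] below [t'], 0 between [t'] and [t], and [phi y - phi t] above
   [t]. *)
have p2_nd x y : x <= y -> p2 x <= p2 y.
  move=> xy; have phixy := phi_nd xy; rewrite /p2.
  have [yt'|yt'] := leP y t'; first by rewrite !cl_low//; lra.
  have [xt'|xt'] := leP x t'.
    rewrite (cl_low x)//; have := phi_nd xt'.
    have [yt|yt] := leP y t; first by rewrite cl_mid//; lra.
    by rewrite (cl_high y (ltW yt)); have := phi_inc yt; lra.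
  have [xt|xt] := leP x t; last first.
    by rewrite (cl_high x (ltW xt)) (cl_high y) ?lerB// (le_trans (ltW xt)).
  rewrite (cl_mid x (ltW xt') xt).
  have [yt|yt] := leP y t; first by rewrite cl_mid//; lra.
  by rewrite (cl_high y (ltW yt)); have := phi_inc yt; lra.
have ip1 K w (wl : lipschitz_with K w) := integrable_comp_lipschitz p1_nd wl.
have ip2 K w (wl : lipschitz_with K w) := integrable_comp_lipschitz p2_nd wl.
have split_int K w : lipschitz_with K w -> \int[lam]_(x in D) phi (w x) =
    \int[lam]_(x in D) p1 (w x) + \int[lam]_(x in D) p2 (w x).
  move=> wl; rewrite -(RintegralD _ (ip1 _ _ wl) (ip2 _ _ wl))//.
  by apply: eq_Rintegral => x _; rewrite /p1 /p2 addrC subrK.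
have p1_le := Rintegral_comp_le p1_nd.
have p2_le := Rintegral_comp_le p2_nd.
have p1_eq : \int[lam]_(x in D) p1 (u x) = \int[lam]_(x in D) p1 (v x).
  apply: (addr_le_eq p1_le p2_le).
  by rewrite -(split_int _ _ u_lip) -(split_int _ _ v_lip).
have d0 : 0 < phi t - phi t' by rewrite subr_gt0 phi_inc.
have lamD : (lam D < +oo)%E by rewrite /= lebesgue_measure_itv_le; [exact: ltry|exact: NLL].
have ic : lam.-integrable D (EFin \o cst (phi t')).
  by apply: measurable_bounded_integrable => //; exact: bounded_cst.
have ind (S : set MR) : measurable S -> S `<=` D ->
  lam.-integrable D (EFin \o (fun x => (phi t - phi t') * \1_S x)) /\
  \int[lam]_(x in D) ((phi t - phi t') * \1_S x) = (phi t - phi t') * fine (lam S).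
  move=> mS SD.
  have i1 : lam.-integrable D (EFin \o \1_S).
    apply: measurable_bounded_integrable => //.
    exists 1; split; first exact: num_real.
    move=> M M1 y _ /=; rewrite indicE; case: (_ \in _); rewrite ?normr1 ?normr0; lra.
  split; last by rewrite RintegralZl// /Rintegral integral_indic// setIidl.
  rewrite (_ : EFin \o _ = fun y => (phi t - phi t')%:E * (EFin \o \1_S) y)%E//.
  exact: integrableZl.
have [|iA eA] := ind _ (measurable_superlevel t v_lip); first by move=> x [].
have [|iB eB] := ind _ (measurable_superlevel t' u_lip); first by move=> x [].
have finS (S : set MR) : measurable S -> S `<=` D -> lam S \is a fin_num.
  move=> mS SD; rewrite ge0_fin_numE//; apply: le_lt_trans lamD.
  by apply: le_measure; rewrite ?inE.
rewrite -(fineK (finS _ (measurable_superlevel t v_lip) _)); last by move=> x [].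
rewrite -(fineK (finS _ (measurable_superlevel t' u_lip) _)); last by move=> x [].
rewrite lee_fin -(ler_pM2l d0) -eA -eB.
have i1 K w (wl : lipschitz_with K w) : lam.-integrable D (EFin \o (fun x => p1 (w x) - phi t')).
  exact: (@integrableB _ _ _ lam D _ _ _ (ip1 _ _ wl) ic).
(* The function [p1 - phi t'] takes values between 0 and [phi t - phi t'], vanishes below [t'] and
   is maximal above [t]. It thus separates the two indicators, and its integrals along [u] and [v]
   agree by [p1_eq]. *)
apply: (@le_trans _ _ (\int[lam]_(x in D) (p1 (v x) - phi t'))).
  apply: le_Rintegral => //; first exact: i1 v_lip.
  move=> x Dx; rewrite indicE.
  case: (boolP (_ \in _)) => [/set_mem[_ tv]|_]; first by rewrite /p1 cl_high// mulr1.
  rewrite mulr0 subr_ge0; apply: phi_nd.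
  by rewrite /cl le_max lexx.
rewrite (RintegralB _ (ip1 _ _ v_lip) ic)// -p1_eq -(RintegralB _ (ip1 _ _ u_lip) ic)//.
apply: le_Rintegral => //; first exact: i1 u_lip.
move=> x Dx; rewrite indicE.
have [tu|tu] := leP t' (u x).
  rewrite mem_set// mulr1 lerD2r; apply: phi_nd.
  by rewrite /cl ge_max ge_min lexx (ltW tt') orbT.
rewrite memNset ?mulr0; last by move=> [_]; rewrite leNgt tu.
by rewrite /= /p1 cl_low ?subrr// ltW.
Qed.

(** If [v] exceeded [t] at the half-width, it would still do so at some larger [y]. Then the
    superlevel set of [u] at level [t] would have measure at least [2 * y], more than the length
    [b - a] of its level interval. *)
Lemma v_level t a b c : - L <= c <= L -> 0 <= t -> t < u c -> level_itv L u t a b ->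
  v ((b - a) / 2) = t.
Proof.
move=> cL t0 tc l; apply/eqP; rewrite eq_le level_le// andbT leNgt; apply/negP => tv.
have [[La ab bL _ _] _] := l.
have w0 : 0 <= (b - a) / 2 by lra.
have wL : (b - a) / 2 < L.
  rewrite lt_neqAle; apply/andP; split; last lra.
  by apply/eqP => wE; move: tv; rewrite wE vL; lra.
have [y [wy yL ty]] := lipschitz_lt_right Kv0 v_lip wL tv.
have y0 : 0 <= y by lra.
have := even_superlevel_ge vN v_ni y0 yL (lexx (v y)).
move=> /le_trans/(_ (superlevel_eq_le ty))/le_trans/(_ (level_measure l)).
rewrite lee_fin; lra.
Qed.

Hypothesis uN : forall x, D x -> u (- x) = u x.
Hypothesis u_ni : forall r s, 0 <= r -> r <= s -> s <= L -> u s <= u r.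

(** Both functions are even and nonincreasing on [0, L]. If their values differed at a positive [y],
    continuity would carry the strict inequality to some [z < y], and comparing superlevel sets
    would give [2 * y <= 2 * z]. *)
Lemma potentials_eq x : - L <= x <= L -> u x = v x.
Proof.
have pos y : 0 < y -> y <= L -> u y = v y.
  move=> y0 yL; apply/eqP; rewrite eq_le !leNgt; apply/andP; split; apply/negP => h.
    have [z [z0 zy hz]] := lipschitz_lt_left Kv0 v_lip y0 h.
    have := le_trans (superlevel_le (u y)) (even_superlevel_le vN v_ni z0 hz).
    move=> /(le_trans (even_superlevel_ge uN u_ni (ltW y0) yL (lexx _))).
    by rewrite lee_fin; lra.
  have [z [z0 zy hz]] := lipschitz_lt_left Ku0 u_lip y0 h.
  (* An intermediate level is required because [superlevel_eq_le] compares [v] only with a strictly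
     lower level of [u]. *)
  pose t' := (u z + v y) / 2.
  have t'v : t' < v y by rewrite /t'; lra.
  have zt' : u z < t' by rewrite /t'; lra.
  have := le_trans (superlevel_eq_le t'v) (even_superlevel_le uN u_ni z0 zt').
  move=> /(le_trans (even_superlevel_ge vN v_ni (ltW y0) yL (lexx _))).
  by rewrite lee_fin; lra.
move=> /andP[h1 h2].
have [x0|x0|->] := ltgtP x 0; last first.
(* At the origin, equality passes to the limit from positive points by the two Lipschitz bounds. *)
- apply/eqP; rewrite -subr_eq0 -normr_le0; apply/ler_addgt0Pr => e e0; rewrite add0r.
  pose y := Num.min L (e / (Ku + Kv + 1)).
  have K1 : 0 < Ku + Kv + 1 by have := Ku0; have := Kv0; lra.
  have y0 : 0 < y by rewrite lt_min L0/= divr_gt0.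
  have yL : y <= L by rewrite ge_min lexx.
  have ye : y * (Ku + Kv + 1) <= e by rewrite -ler_pdivlMr// ge_min lexx orbT.
  have -> : u 0 - v 0 = (u 0 - u y) + (v y - v 0) by rewrite (pos y y0 yL); lra.
  have := u_lip 0 y; have := v_lip y 0.
  rewrite sub0r subr0 normrN (gtr0_norm y0) => b1 b2.
  by apply: le_trans (ler_normD _ _) _; lra.
- by apply: pos.
- have Dx : D x by rewrite /= in_itv/=; apply/andP.
  by rewrite -uN// -vN//; apply: pos; lra.
Qed.

End equality.
End superlevel_sets.

(** * Comparison of the potentials *)

(** Were [phi y <= phi x], strict convexity would put the value at the midpoint strictly below
    [phi x], against monotonicity. *)
Lemma strictly_convex_increasing (R : realType) (phi : R -> R) :
  strictly_convex_fun phi -> nondecr_fun phi -> forall x y, x < y -> phi x < phi y.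
Proof.
move=> sc nd x y xy; rewrite ltNge; apply/negP => yx.
have xNy : x != y by rewrite lt_eqF.
have := sc x y 2^-1 xNy ltac:(apply/andP; split; lra).
have : phi x <= phi (2^-1 * x + (1 - 2^-1) * y) by apply: nd; lra.
lra.
Qed.

Section symmetrization.
Context {R : realType}.
Local Notation MR := (measurableTypeR R).
Local Notation lam := (@lebesgue_measure R).
Local Notation I := (`](- pi)%R, pi[%classic : set MR).
Local Notation D := (`[(- pi)%R, pi]%classic : set MR).
Variables (mu s musharp : {measure set MR -> \bar R}) (f : R -> R).
Hypothesis muCI : mu (~` I) = 0%E.
Hypothesis muI : (mu I < +oo)%E.
Hypothesis mf : measurable_fun D f.
Hypothesis f0 : forall x, D x -> 0 <= f x.
Hypothesis intf : lam.-integrable D (EFin \o f).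
Hypothesis sCI : s (~` I) = 0%E.
Hypothesis s_sing : exists N, measurable N /\ lam N = 0%E /\ s (~` N) = 0%E.
Hypothesis muE : forall A, measurable A ->
  mu A = (\int[lam]_(x in A `&` I) (f x)%:E + s A)%E.
Hypothesis musharpE : forall A, measurable A ->
  musharp A = (\int[lam]_(x in A `&` I) sym_rearr f x + s I * \d_(0%R : R) A)%E.

Let mI : measurable I. Proof. exact: measurable_itv. Qed.
Let mD : measurable D. Proof. exact: measurable_itv. Qed.
Let ID : I `<=` D.
Proof. by move=> x; rewrite /= !in_itv/= => /andP[/ltW -> /ltW ->]. Qed.

Let s_le_mu A : measurable A -> (s A <= mu A)%E.
Proof.
move=> mA; rewrite muE// leeDr// integral_ge0// => x [_ /ID Dx].
by rewrite lee_fin f0.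
Qed.

Let sI : (s I < +oo)%E. Proof. exact: le_lt_trans (s_le_mu mI) muI. Qed.

Let musharp_sym_rearr_real A : measurable A ->
  musharp A = (\int[lam]_(x in A `&` I) (sym_rearr_real f x)%:E + s I * \d_(0%R : R) A)%E.
Proof. by move=> mA; rewrite musharpE// integral_sym_rearr_real. Qed.

Let I0 : I 0. Proof. by have p := pi_gt0 R; rewrite /= in_itv/=; apply/andP; split; lra. Qed.

Lemma musharpCI : musharp (~` I) = 0%E.
Proof.
rewrite musharp_sym_rearr_real; last exact: measurableC.
by rewrite setICl integral_set0 diracE memNset ?mule0 ?adde0// => /(_ I0).
Qed.

Lemma musharpI : (musharp I < +oo)%E.
Proof.
rewrite musharp_sym_rearr_real// setIid diracE mem_set// mule1 lte_add_pinfty//.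
apply: le_lt_trans (integral_sym_rearr_real_le mf f0 intf) _.
case/integrableP : intf => _; apply: le_lt_trans; apply: ge0_le_integral => //.
- exact/measurable_EFinP.
- by apply: measurableT_comp => //; exact/measurable_EFinP.
- by move=> x _; exact: lee_abs.
Qed.

Lemma musharpN (A : set MR) : measurable A -> musharp [set x : R | A (- x)] = musharp A.
Proof.
move=> mA.
have mNA : measurable ([set x : R | A (- x)] : set MR).
  have := @oppr_measurable R setT measurableT A mA; rewrite setTI; exact.
rewrite !musharp_sym_rearr_real// integral_sym_rearr_real_even//; congr (_ + _ * _)%E.
suff e : ((0 : R) \in [set x : R | A (- x)]) = ((0 : R) \in A) by rewrite !diracE e.
by apply/idP/idP => /set_mem/= h; apply/mem_set; rewrite /= ?oppr0// -oppr0.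
Qed.

(** The density part is the Hardy-Littlewood inequality. The singular mass of ]a, b[ is at most the
    total singular mass, which [musharp] places at the origin, inside the centred interval. *)
Lemma mu_itv_le_musharp (a b : R) : - pi <= a -> a < b -> b <= pi ->
  (mu `]a, b[%classic <= musharp `](- ((b - a) / 2))%R, ((b - a) / 2)%R[%classic)%E.
Proof.
move=> pia ab bpi.
have m1 : measurable (`]a, b[%classic : set MR) by exact: measurable_itv.
have m2 : measurable (`](- ((b - a) / 2))%R, ((b - a) / 2)%R[%classic : set MR).
  exact: measurable_itv.
rewrite muE// musharp_sym_rearr_real//; apply: leeD.
  rewrite !setIidl; first exact: hardy_littlewood_itv (ltW ab) bpi.
    by move=> x; rewrite /= !in_itv/= => /andP[? ?]; apply/andP; split; lra.
  by move=> x; rewrite /= !in_itv/= => /andP[? ?]; apply/andP; split; lra.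
rewrite diracE mem_set ?mule1/=; last by rewrite in_itv/=; apply/andP; split; lra.
by rewrite -(measure_setI_supp sCI m1); apply: le_measure; rewrite ?inE//; exact: measurableI.
Qed.

Local Notation u := (green_pot mu).
Local Notation v := (green_pot musharp).
Let F r := fine (musharp `](- r)%R, r[%classic).

Let F_ge0 r : 0 <= F r. Proof. exact: fine_ge0. Qed.

Let F_ndecr r t : 0 <= r -> r <= t -> t <= pi -> F r <= F t.
Proof.
move=> r0 rt tpi; apply: fine_le.
- by apply: (measure_fin musharpI musharpCI); exact: measurable_itv.
- by apply: (measure_fin musharpI musharpCI); exact: measurable_itv.
apply: le_measure; rewrite ?inE//.
by move=> x; rewrite /= !in_itv/= => /andP[? ?]; apply/andP; split; lra.
Qed.

Let slopes_le (a a' b' b : R) : - pi <= a -> a < a' -> a' <= b' -> b' < b -> b <= pi ->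
  (u a' - u a) / (a' - a) + (u b' - u b) / (b - b') <= F ((b - a) / 2).
Proof.
move=> pia aa' a'b' b'b bpi.
apply: le_trans (potential_slopes_le muI muCI aa' a'b' b'b) _.
apply: fine_le.
- by apply: (measure_fin muI muCI); exact: measurable_itv.
- by apply: (measure_fin musharpI musharpCI); exact: measurable_itv.
by apply: mu_itv_le_musharp => //; lra.
Qed.

Let v_even x : v (- x) = v x.
Proof. exact: (potential_even musharpI musharpN). Qed.

Let v_drop (r t : R) : 0 <= r -> r <= t -> t <= pi -> (t - r) * F r <= 2 * (v r - v t).
Proof.
move=> r0 rt _; apply: le_trans (potential_drop musharpI musharpCI r0 rt) _.
by rewrite !v_even; lra.
Qed.

Let Ku0 : 0 <= fine (mu setT). Proof. exact: fine_ge0. Qed.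
Let Kv0 : 0 <= fine (musharp setT). Proof. exact: fine_ge0. Qed.
Let u_lip := potential_lip muI muCI.
Let v_lip := potential_lip musharpI musharpCI.

Let u_ge0 x : D x -> 0 <= u x.
Proof.
rewrite /= in_itv/= => /andP[h1 h2].
by apply: (potential_qconcave muI muCI h1 h2); rewrite ?potential_pi ?potential_Npi.
Qed.

Let v_ni := v_nincr F_ge0 v_drop.

Let level_le := level_le_v Ku0 u_lip (potential_Npi mu) (potential_pi mu)
  slopes_le F_ndecr F_ge0 (potential_pi musharp) v_drop.

Let vN x : D x -> v (- x) = v x. Proof. by []. Qed.

Lemma potential_comparison (phi : R -> R) : nondecr_fun phi ->
  \int[lam]_(x in D) phi (u x) <= \int[lam]_(x in D) phi (v x).
Proof.
move=> nd; apply: (Rintegral_comp_le (pi_gt0 R) Ku0 u_lip v_lip (potential_Npi mu)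
  (potential_pi mu) u_ge0 vN (potential_pi musharp) v_ni level_le).
exact: nd.
Qed.

(** Equality of the integrals gives [v_level], which makes [u] even and nonincreasing on [0, pi];
    then the potentials coincide, and so do the measures. *)
Lemma potential_rigidity (phi : R -> R) : (forall x y, x < y -> phi x < phi y) ->
  \int[lam]_(x in D) phi (u x) = \int[lam]_(x in D) phi (v x) ->
  forall A, measurable A -> mu A = musharp A.
Proof.
move=> inc eq.
have v_lev := v_level (pi_gt0 R) Ku0 Kv0 u_lip v_lip (potential_Npi mu)
  (potential_pi mu) u_ge0 vN (potential_pi musharp) v_ni level_le inc eq.
have qc := potential_qconcave muI muCI.
have uN := u_even Ku0 u_lip (potential_Npi mu) (potential_pi mu) slopes_le F_ndecr
  v_drop v_lev qc.
have uni := u_nincr Ku0 u_lip (potential_Npi mu) (potential_pi mu) slopes_le F_ndecr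
  v_drop v_lev qc.
apply: potential_inj => //; [exact: musharpI|exact: musharpCI|].
apply: (potentials_eq (pi_gt0 R) Ku0 Kv0 u_lip v_lip (potential_Npi mu)
  (potential_pi mu) u_ge0 vN (potential_pi musharp) v_ni level_le inc eq _ uni).
by move=> x; rewrite /= in_itv/=; exact: uN.
Qed.

(** If the measures agree, removing a null set that carries both singular parts shows that the
    densities have equal integrals over every measurable subset of [I], hence agree almost
    everywhere. Cancelling the finite density part identifies the singular parts. *)
Lemma symmetrization_fixed : (forall A, measurable A -> mu A = musharp A) <->
  ({ae lam, forall x, I x -> (f x)%:E = sym_rearr f x} /\
   (forall A, measurable A -> s A = (s I * \d_(0%R : R) A)%E)).
Proof.
have mfI : measurable_fun I (EFin \o f).
  by apply/measurable_EFinP; apply: measurable_funS mf.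
have mgI : measurable_fun I (EFin \o sym_rearr_real f).
  by apply/measurable_EFinP; exact: measurable_sym_rearr_real.
have ne0 : {ae lam, forall x : MR, x != 0}.
  exists [set 0]; split; [exact: measurable_set1|exact: lebesgue_measure_set1|].
  by move=> x /= /negP; rewrite negbK => /eqP.
split=> [mu_eq|[f_eq s_eq] A mA]; last first.
  rewrite muE// musharp_sym_rearr_real// s_eq//; congr (_ + _)%E.
  apply: ae_eq_integral => //; first exact: measurableI.
  - by apply: measurable_funS mfI.
  - by apply: measurable_funS mgI.
  apply: filterS2 f_eq ne0 => x fx x0 [_ Ix] /=.
  by rewrite fx// sym_rearr_realE.
have [N [mN [N0 sN]]] := s_sing.
have m0 : measurable ([set 0] : set MR) by exact: measurable_set1.
(* [N] carries [s] and the added origin carries the Dirac mass of [musharp]. *)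
pose N' : set MR := N `|` [set 0].
have mN' : measurable N' by exact: measurableU.
have N'0 : lam N' = 0%E by rewrite measureU0//; exact: lebesgue_measure_set1.
have int_eq (A : set MR) : measurable A -> A `<=` I ->
    (\int[lam]_(x in A) (f x)%:E = \int[lam]_(x in A) (sym_rearr_real f x)%:E)%E.
  move=> mA AI.
  have mAN : measurable (A `\` N') by exact: measurableD.
  have ANI : (A `\` N') `&` I = A `\` N' by apply/setIidl => x [/AI].
  rewrite (ge0_negligible_integral mN')//; last 2 first.
  - by apply: measurable_funS mfI.
  - by move=> x /AI/ID Dx; rewrite lee_fin f0.
  rewrite [RHS](ge0_negligible_integral mN')//; last 2 first.
  - by apply: measurable_funS mgI.
  - by move=> x /AI Ix; rewrite lee_fin (sym_rearr_real_ge0 mf f0 intf).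
  have := mu_eq _ mAN; rewrite muE// musharp_sym_rearr_real// ANI.
  have -> : s (A `\` N') = 0%E.
    apply/eqP; rewrite eq_le measure_ge0 andbT -sN; apply: le_measure.
    - by rewrite inE.
    - by rewrite inE; exact: measurableC.
    - by move=> x [_ h] Nx; apply: h; left.
  rewrite adde0 diracE memNset ?mule0 ?adde0//.
  by move=> [_]; apply; right.
have fI : lam.-integrable I (EFin \o f) by exact: integrableS intf.
split=> [|A mA].
  have aeq : ae_eq lam I (EFin \o f) (EFin \o sym_rearr_real f).
    by apply: integral_ae_eq => // E EI mE; exact: int_eq.
  apply: filterS2 aeq ne0 => x fx x0 Ix.
  by have := fx Ix; rewrite /= sym_rearr_realE.
have mAI : measurable (A `&` I) by exact: measurableI.
have := mu_eq A mA; rewrite muE// musharp_sym_rearr_real// -int_eq//.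
have finf : (\int[lam]_(x in A `&` I) (f x)%:E)%E \is a fin_num.
  by apply: integrable_fin_num => //; exact: integrableS fI.
rewrite addeC [RHS]addeC => /(congr1 (fun z => z - \int[lam]_(x in A `&` I) (f x)%:E)%E).
by rewrite !addeK.
Qed.

End symmetrization.

(** * Passage from real-valued to extended-real integrals *)

Local Open Scope ereal_scope.

Theorem theorem1p3 (R : realType)
  (mu : {measure set (measurableTypeR R) -> \bar R})
  (f : R -> R)
  (s : {measure set (measurableTypeR R) -> \bar R})
  (musharp : {measure set (measurableTypeR R) -> \bar R}) :
  (* mu is a finite, nonzero Borel measure on (-pi,pi) *)
  mu (~` `](- pi)%R, pi[%classic) = 0%E ->
  (mu `](- pi)%R, pi[%classic < +oo)%E ->
  mu `](- pi)%R, pi[%classic <> 0%E ->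
  (* Lebesgue decomposition mu = f dlambda + s, f = Radon-Nikodym derivative,
     s = singular part (sigma + delta) *)
  measurable_fun `[(- pi)%R, pi]%classic f ->
  (forall x, `[(- pi)%R, pi]%classic x -> (0 <= f x)%R) ->
  (@lebesgue_measure R).-integrable `[(- pi)%R, pi]%classic (EFin \o f) ->
  s (~` `](- pi)%R, pi[%classic) = 0%E ->
  (exists N, measurable N /\ @lebesgue_measure R N = 0%E /\ s (~` N) = 0%E) ->
  (forall A, measurable A ->
     mu A = (\int[@lebesgue_measure R]_(x in A `&` `](- pi)%R, pi[%classic) (f x)%:E
             + s A)%E) ->
  (* musharp is the symmetrization: d musharp = f^# dlambda + M d delta_0 *)
  (forall A, measurable A ->
     musharp A = (\int[@lebesgue_measure R]_(x in A `&` `](- pi)%R, pi[%classic) sym_rearr f x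
                  + s `](- pi)%R, pi[%classic * \d_(0%R : R) A)%E) ->
  forall phi : R -> R, convex_fun phi -> nondecr_fun phi ->
    (\int[@lebesgue_measure R]_(x in `[(- pi)%R, pi]%classic) (phi (green_pot mu x))%:E
      <= \int[@lebesgue_measure R]_(x in `[(- pi)%R, pi]%classic) (phi (green_pot musharp x))%:E)%E
    /\
    (strictly_convex_fun phi ->
      ((\int[@lebesgue_measure R]_(x in `[(- pi)%R, pi]%classic) (phi (green_pot mu x))%:E
        = \int[@lebesgue_measure R]_(x in `[(- pi)%R, pi]%classic) (phi (green_pot musharp x))%:E)
       <->
       ({ae @lebesgue_measure R, forall x, `](- pi)%R, pi[%classic x -> (f x)%:E = sym_rearr f x}
        /\ (forall A, measurable A -> s A = (s `](- pi)%R, pi[%classic * \d_(0%R : R) A)%E)))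
      /\
      ((\int[@lebesgue_measure R]_(x in `[(- pi)%R, pi]%classic) (phi (green_pot mu x))%:E
        = \int[@lebesgue_measure R]_(x in `[(- pi)%R, pi]%classic) (phi (green_pot musharp x))%:E)
       <-> (forall A, measurable A -> mu A = musharp A))).
Proof.
move=> muCI muI _ mf f0 intf sCI s_sing muE musharpE phi _ nd.
have musI := musharpI muI mf f0 intf muE musharpE.
have musCI := musharpCI mf f0 intf musharpE.
(* Finiteness of both integrals lets the comparison of their [fine] parts be read in the extended
   reals. *)
have finu : (\int[@lebesgue_measure R]_(x in `[(- pi)%R, pi]%classic) (phi (green_pot mu x))%:E)%E
    \is a fin_num.
  apply: integrable_fin_num => //.
  exact: (integrable_comp_lipschitz (pi_gt0 R) nd (potential_lip muI muCI)).
have finv : (\int[@lebesgue_measure R]_(x in `[(- pi)%R, pi]%classic) (phi (green_pot musharp x))%:E)%E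
    \is a fin_num.
  apply: integrable_fin_num => //.
  exact: (integrable_comp_lipschitz (pi_gt0 R) nd (potential_lip musI musCI)).
have le := potential_comparison muCI muI mf f0 intf sCI muE musharpE nd.
split; first by rewrite -(fineK finu) -(fineK finv) lee_fin.
move=> sc.
have fixedP := symmetrization_fixed mf f0 intf s_sing muE musharpE.
have eqP' : (\int[@lebesgue_measure R]_(x in `[(- pi)%R, pi]%classic) (phi (green_pot mu x))%:E
        = \int[@lebesgue_measure R]_(x in `[(- pi)%R, pi]%classic) (phi (green_pot musharp x))%:E)%E
    <-> (forall A, measurable A -> mu A = musharp A).
  split => [eq|eq].
    apply: (potential_rigidity muCI muI mf f0 intf sCI muE musharpE
      (strictly_convex_increasing sc nd)).
    by rewrite /Rintegral eq.
  apply: eq_integral => x _; congr (phi _)%:E; congr fine.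
  by apply: eq_measure_integral => A mA _; exact: eq.
by split; first rewrite eqP'.
Qed.
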